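(* Let $k\ge 2$ be an integer. The theory $\mathsf{T}_k$ axiomatizes $\mathsf{BA}_k$; that is, for every $\mathcal L_{\mathsf{BA}}$-sentence $\varphi$, $\mathsf{T}_k\vdash\varphi$ if and only if $\varphi\in\mathsf{BA}_k$. In particular, $\mathsf{BA}_k$ admits a $\Pi_1$-axiomatization, i.e. there is a set of $\Pi_1$-sentences whose set of logical consequences (among $\mathcal L_{\mathsf{BA}}$-sentences) is exactly $\mathsf{BA}_k$.
   Context: Fix an integer $k\ge 2$. $\mathcal L_{\mathsf{BA}}=(0,S,+,V_k,\le)$ is a first-order language with equality ($S,V_k$ unary functions, $+$ binary function, $\le$ binary relation); $x<y$ means $x\le y\wedge x\neq y$. The standard model is $\mathbb N$ with the usual $0$, successor, addition and order, where $V_k(x)$ is the largest power of $k$ dividing $x$ for $x>0$, and $V_k(0)=0$. $\mathsf{BA}_k$ is the set of all $\mathcal L_{\mathsf{BA}}$-sentences true in the standard model. Terms: $\underline n=S(S(\dots S(0)\dots))$ ($n$ times); for a term $t$ and $n\in\mathbb N$, $nt=t+(t+(\dots(t+0)\dots))$ ($n$ copies of $t$). A formula is $\Delta_0$ (bounded) if every quantifier in it is of the form $\exists x\le t$ or $\forall x\le t$ with $x$ not occurring in the term $t$ (quantifiers bounded by $<t$ are treated as abbreviations in the usual way). $\Pi_1$ is the set of formulas $\forall \vec x\,\theta$ with $\theta\in\Delta_0$. Abbreviations: $P_k(d):\iff d>0\wedge V_k(d)=d$; $x\equiv_k y:\iff \exists z\le x+y\ (x=y+kz\vee y=x+kz)$;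 for $a\in\{0,\dots,k-1\}$, $(x)_d=a:\iff P_k(d)\wedge\exists y<d\ \exists z\le x\ \big(x=y+ad+z\wedge(z=0\vee V_k(z)>d)\big)$; $\exists^{P_k}d\,\varphi$ means $\exists d\,(P_k(d)\wedge\varphi)$ and $\forall^{P_k}d\,\varphi$ means $\forall d\,(P_k(d)\to\varphi)$, similarly with bounds on $d$. The theory $\mathsf{T}_k$ consists of the universal closures of: (Add) the axioms of discretely ordered commutative cancellative monoids: $+$ is commutative, associative, cancellative with neutral element $0$; $\le$ is a linear order compatible with $+$; $S(x)=x+S(0)$; and $x<y\leftrightarrow S(x)\le y$; (Ord0) $x\ge 0$; (Ord1) $x\le y\leftrightarrow\exists z\le y\,(z+x=y)$; (Mod) $\bigvee_{a=0}^{k-1}(x\equiv_k\underline a)$; (V0) $V_k(0)=0$, $V_k(\underline 1)=\underline 1$; (V1) $V_k(kx)=kV_k(x)$, and $P_k(d)\to\bigwedge_{a=1}^{k-1}(V_k(ad)=d)$; (V2) $(x>0\wedge y>0\wedge V_k(x)<V_k(y))\to V_k(x+y)=V_k(x)$; (V3) $x>0\to\exists y\le x\ \bigvee_{a=1}^{k-1}\big(x=y+aV_k(x)\wedge(V_k(y)>V_k(x)\vee y=0)\big)$; (V4) $x>0\to\exists^{P_k}d\le x\ (d\le x<kd)$; (V5) $V_k(V_k(x))=V_k(x)$; (Comp) $P_k(d)\to\exists x<d\ \forall^{P_k}d'<d\ \Big(\big((x)_{d'}=1\wedge\varphi(d',\vec y)\big)\vee\big((x)_{d'}=0\wedge\neg\varphi(d',\vec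 y)\big)\Big)$, for every $\Delta_0$-formula $\varphi(d,\vec y)$ (free variables among $d,\vec y$). *)

(* Defs.v *)
From Stdlib Require List.
From mathcomp Require Import all_boot.

Set Implicit Arguments.
Unset Strict Implicit.
Unset Printing Implicit Defensive.

(* First-order syntax over (0, S, +, V, <=) with equality, in de Bruijn style:
   TVar n refers to the n-th enclosing quantifier, and to a free variable once
   the enclosing quantifiers are exhausted.  The symbol V is V_k; the base k
   enters only through the standard model and the axioms. *)

Inductive term : Type :=
  | TVar of nat
  | TZero
  | TSucc of term
  | TAdd of term & term
  | TV of term.

Inductive form : Type :=
  | FBot
  | FEq of term & term
  | FLe of term & term
  | FAnd of form & form
  | FOr of form & form
  | FImp of form & form
  | FAll of form
  | FEx of form.

Definition FNot A := FImp A FBot.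
Definition FTop := FNot FBot.
Definition FIff A B := FAnd (FImp A B) (FImp B A).
Definition FLt s t := FAnd (FLe s t) (FNot (FEq s t)).

Declare Scope fol_scope.
Delimit Scope fol_scope with fol.
Bind Scope fol_scope with term form.

Notation "# n" := (TVar n) (at level 2, n at level 1, format "# n") : fol_scope.
Infix "+'" := TAdd (at level 50, left associativity) : fol_scope.
Infix "='" := FEq (at level 70, no associativity) : fol_scope.
Infix "<='" := FLe (at level 70, no associativity) : fol_scope.
Infix "<'" := FLt (at level 70, no associativity) : fol_scope.
Notation "~' A" := (FNot A) (at level 75, right associativity) : fol_scope.
Infix "/\'" := FAnd (at level 80, right associativity) : fol_scope.
Infix "\/'" := FOr (at level 85, right associativity) : fol_scope.
Infix "->'" := FImp (at level 90, right associativity) : fol_scope.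
Infix "<->'" := FIff (at level 95, no associativity) : fol_scope.

Local Open Scope fol_scope.

Fixpoint tsubst (sigma : nat -> term) (t : term) : term :=
  match t with
  | TVar n => sigma n
  | TZero => TZero
  | TSucc u => TSucc (tsubst sigma u)
  | TAdd u v => TAdd (tsubst sigma u) (tsubst sigma v)
  | TV u => TV (tsubst sigma u)
  end.

Definition tshift : term -> term := tsubst (fun n => #(n.+1)).

Definition up (sigma : nat -> term) (n : nat) : term :=
  if n is m.+1 then tshift (sigma m) else #0.

Fixpoint fsubst (sigma : nat -> term) (A : form) : form :=
  match A with
  | FBot => FBot
  | FEq s t => FEq (tsubst sigma s) (tsubst sigma t)
  | FLe s t => FLe (tsubst sigma s) (tsubst sigma t)
  | FAnd B C => FAnd (fsubst sigma B) (fsubst sigma C)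
  | FOr B C => FOr (fsubst sigma B) (fsubst sigma C)
  | FImp B C => FImp (fsubst sigma B) (fsubst sigma C)
  | FAll B => FAll (fsubst (up sigma) B)
  | FEx B => FEx (fsubst (up sigma) B)
  end.

Definition fshift : form -> form := fsubst (fun n => #(n.+1)).

(* A[t/#0], the remaining free variables being lowered by one. *)
Definition finst (A : form) (t : term) : form :=
  fsubst (fun n => if n is m.+1 then #m else t) A.

(* Least n such that every free variable is #i with i < n. *)
Fixpoint tbound (t : term) : nat :=
  match t with
  | TVar n => n.+1
  | TZero => 0
  | TSucc u => tbound u
  | TAdd u v => maxn (tbound u) (tbound v)
  | TV u => tbound u
  end.

Fixpoint fbound (A : form) : nat :=
  match A with
  | FBot => 0
  | FEq s t | FLe s t => maxn (tbound s) (tbound t)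
  | FAnd B C | FOr B C | FImp B C => maxn (fbound B) (fbound C)
  | FAll B | FEx B => (fbound B).-1
  end.

Definition sentence (A : form) : Prop := fbound A = 0.

Definition uclosure (A : form) : form := iter (fbound A) FAll A.

(* Classical natural deduction with equality.  Shifting the context makes #0
   the fresh eigenvariable of prv_AllI and prv_ExE. *)
Inductive prv : seq form -> form -> Prop :=
  | prv_Hyp G A : List.In A G -> prv G A
  | prv_RAA G A : prv ((~' A) :: G) FBot -> prv G A
  | prv_AndI G A B : prv G A -> prv G B -> prv G (A /\' B)
  | prv_AndE1 G A B : prv G (A /\' B) -> prv G A
  | prv_AndE2 G A B : prv G (A /\' B) -> prv G B
  | prv_OrI1 G A B : prv G A -> prv G (A \/' B)
  | prv_OrI2 G A B : prv G B -> prv G (A \/' B)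
  | prv_OrE G A B C :
      prv G (A \/' B) -> prv (A :: G) C -> prv (B :: G) C -> prv G C
  | prv_ImpI G A B : prv (A :: G) B -> prv G (A ->' B)
  | prv_ImpE G A B : prv G (A ->' B) -> prv G A -> prv G B
  | prv_AllI G A : prv (map fshift G) A -> prv G (FAll A)
  | prv_AllE G A t : prv G (FAll A) -> prv G (finst A t)
  | prv_ExI G A t : prv G (finst A t) -> prv G (FEx A)
  | prv_ExE G A C :
      prv G (FEx A) -> prv (A :: map fshift G) (fshift C) -> prv G C
  | prv_EqI G t : prv G (t =' t)
  | prv_EqE G A s t : prv G (s =' t) -> prv G (finst A s) -> prv G (finst A t).

Definition theory := form -> Prop.

Definition provable (T : theory) (A : form) : Prop :=
  exists2 G : seq form, (forall B, List.In B G -> T B) & prv G A.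

Notation "T |-' A" := (provable T A) (at level 99, no associativity).

Record structure : Type := Structure {
  carrier :> Type;
  s_zero : carrier;
  s_succ : carrier -> carrier;
  s_add : carrier -> carrier -> carrier;
  s_V : carrier -> carrier;
  s_le : carrier -> carrier -> Prop }.

Definition scons (M : Type) (a : M) (rho : nat -> M) (n : nat) : M :=
  if n is m.+1 then rho m else a.

Fixpoint teval (M : structure) (rho : nat -> M) (t : term) : M :=
  match t with
  | TVar n => rho n
  | TZero => s_zero M
  | TSucc u => s_succ (teval rho u)
  | TAdd u v => s_add (teval rho u) (teval rho v)
  | TV u => s_V (teval rho u)
  end.

Fixpoint sat (M : structure) (rho : nat -> M) (A : form) : Prop :=
  match A with
  | FBot => False
  | FEq s t => teval rho s = teval rho t
  | FLe s t => s_le (teval rho s) (teval rho t)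
  | FAnd B C => sat rho B /\ sat rho C
  | FOr B C => sat rho B \/ sat rho C
  | FImp B C => sat rho B -> sat rho C
  | FAll B => forall a : M, sat (scons a rho) B
  | FEx B => exists a : M, sat (scons a rho) B
  end.

Definition models (M : structure) (A : form) : Prop :=
  forall rho : nat -> M, sat rho A.

(* For k >= 2 and x > 0, k ^ i %| x forces i <= x, so the range of the maximum
   is no restriction. *)
Definition Vnat (k x : nat) : nat :=
  if x == 0 then 0 else \max_(i < x.+1 | k ^ i %| x) k ^ i.

Definition stdmodel (k : nat) : structure :=
  Structure 0 S addn (Vnat k) (fun x y => x <= y).

Definition BA (k : nat) : theory :=
  fun A => sentence A /\ models (stdmodel k) A.

Definition tnum (n : nat) : term := iter n TSucc TZero.
Definition tmul (n : nat) (t : term) : term := iter n (TAdd t) TZero.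

(* Bounded quantifiers.  The bound t is read outside the quantifier, whence
   the shift; the bound variable is #0 in A.  "< t" abbreviates "<= t" together
   with "distinct from t". *)
Definition FExle (t : term) (A : form) := FEx (#0 <=' tshift t /\' A).
Definition FAllle (t : term) (A : form) := FAll (#0 <=' tshift t ->' A).
Definition FExlt (t : term) (A : form) := FExle t (~' (#0 =' tshift t) /\' A).
Definition FAlllt (t : term) (A : form) := FAllle t (~' (#0 =' tshift t) ->' A).

Inductive Delta0 : form -> Prop :=
  | Delta0_Bot : Delta0 FBot
  | Delta0_Eq s t : Delta0 (s =' t)
  | Delta0_Le s t : Delta0 (s <=' t)
  | Delta0_And A B : Delta0 A -> Delta0 B -> Delta0 (A /\' B)
  | Delta0_Or A B : Delta0 A -> Delta0 B -> Delta0 (A \/' B)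
  | Delta0_Imp A B : Delta0 A -> Delta0 B -> Delta0 (A ->' B)
  | Delta0_Allle t A : Delta0 A -> Delta0 (FAllle t A)
  | Delta0_Exle t A : Delta0 A -> Delta0 (FExle t A).

Definition Pi1 (A : form) : Prop :=
  exists (n : nat) (B : form), Delta0 B /\ A = iter n FAll B.

Definition isP (d : term) : form := TZero <' d /\' TV d =' d.

(* x congruent to y modulo k; #0 is the witness z. *)
Definition congr_mod (k : nat) (x y : term) : form :=
  FExle (x +' y)
    (tshift x =' tshift y +' tmul k #0 \/' tshift y =' tshift x +' tmul k #0).

(* (x)_d = a: x = y + a d + z, with y = #1 and z = #0 in the matrix. *)
Definition digit (x d : term) (a : nat) : form :=
  let x2 := tshift (tshift x) in let d2 := tshift (tshift d) in
  isP d /\'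
  FExlt d (FExle (tshift x)
    (x2 =' #1 +' tmul a d2 +' #0 /\' (#0 =' TZero \/' d2 <' TV #0))).

(* The matrices of the axioms; the theory consists of their universal
   closures.  Free variables: #0, #1, #2 in the order x, y, z. *)
Inductive Tax (k : nat) : form -> Prop :=
  | Add_comm : Tax k (#0 +' #1 =' #1 +' #0)
  | Add_assoc : Tax k ((#0 +' #1) +' #2 =' #0 +' (#1 +' #2))
  | Add_cancel : Tax k (#0 +' #2 =' #1 +' #2 ->' #0 =' #1)
  | Add_zero : Tax k (#0 +' TZero =' #0)
  | Le_refl : Tax k (#0 <=' #0)
  | Le_antisym : Tax k (#0 <=' #1 ->' #1 <=' #0 ->' #0 =' #1)
  | Le_trans : Tax k (#0 <=' #1 ->' #1 <=' #2 ->' #0 <=' #2)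
  | Le_total : Tax k (#0 <=' #1 \/' #1 <=' #0)
  | Le_add : Tax k (#0 <=' #1 ->' #0 +' #2 <=' #1 +' #2)
  | Succ_add : Tax k (TSucc #0 =' #0 +' TSucc TZero)
  | Lt_succ : Tax k (#0 <' #1 <->' TSucc #0 <=' #1)
  | Ord0 : Tax k (TZero <=' #0)
  (* in the scope of the quantifier z = #0, x = #1, y = #2 *)
  | Ord1 : Tax k (#0 <=' #1 <->' FExle #1 (#0 +' #1 =' #2))
  | Mod : Tax k (\big[FOr/FBot]_(0 <= a < k) congr_mod k #0 (tnum a))
  | V0_zero : Tax k (TV TZero =' TZero)
  | V0_one : Tax k (TV (tnum 1) =' tnum 1)
  | V1_base : Tax k (TV (tmul k #0) =' tmul k (TV #0))
  | V1_digit :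
      Tax k (isP #0 ->' \big[FAnd/FTop]_(1 <= a < k) (TV (tmul a #0) =' #0))
  | V2 :
      Tax k (TZero <' #0 /\' TZero <' #1 /\' TV #0 <' TV #1 ->'
             TV (#0 +' #1) =' TV #0)
  (* in the scope of the quantifier y = #0, x = #1 *)
  | V3 :
      Tax k (TZero <' #0 ->'
             FExle #0 (\big[FOr/FBot]_(1 <= a < k)
               (#1 =' #0 +' tmul a (TV #1) /\'
                (TV #1 <' TV #0 \/' #0 =' TZero))))
  (* in the scope of the quantifier d = #0, x = #1 *)
  | V4 :
      Tax k (TZero <' #0 ->'
             FExle #0 (isP #0 /\' #0 <=' #1 /\' #1 <' tmul k #0))
  | V5 : Tax k (TV (TV #0) =' TV #0)
  (* A has #0 = d and #(i+1) = y_i; at its place of occurrence d' = #0, x = #1,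
     d = #2 and y_i = #(i+3), hence the renaming, which keeps x and the outer d
     out of A. *)
  | Comp A : Delta0 A ->
      let A' := fsubst (up (fun i => #(i.+2))) A in
      Tax k (isP #0 ->'
             FExlt #0 (FAlllt #1 (isP #0 ->'
               (digit #1 #0 1 /\' A') \/' (digit #1 #0 0 /\' ~' A')))).

Definition Tk (k : nat) : theory :=
  fun A => exists2 B : form, Tax k B & A = uclosure B.

(* Main.v *)
From Stdlib Require Import Classical ClassicalEpsilon FunctionalExtensionality.
From Stdlib Require Import PropExtensionality ProofIrrelevance.
From mathcomp Require Import all_boot zify.
Require Import Defs.

(** [Tk] is true in the standard model, so what it proves is true.  For the
    converse, by the completeness theorem, every model [M] of [Tk] has to
    satisfy the sentences true in the standard model ([Tk_elementary]).  The
    reason is that first-order definable relations are recognized by finite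
    automata reading the base-[k] digits of their arguments, that each automaton
    works in every model of [Tk] at once, and that the truth of a sentence
    is read off its initial state.

    The automata need not be coded in [M].  The state reached after reading the
    digits of [rho] below the power [D] is itself a bounded property of [D] and
    [rho], where all entries of [rho] are below [D].  For [x + y = z] it says
    which carry [c] satisfies [x + y = z + c D]; for [exists a, R] it is the set
    of the states that the automaton of [R] reaches with some [a] below [D].
    What makes this an automaton is that prefixing one digit at the position [D]
    changes the state by a transition function that does not depend on [M]
    ([tracks_step]).  This follows at each connective with no induction in [M],
    because a number below [k D] is a number below [D] plus a multiple of [D]
    by a digit ([split_lt]).  Runs therefore never have to be constructed.

    Comprehension enters at one place.  A witness of an unbounded quantifier may
    have more digits than the parameters, so one has to know which states can be
    reached by reading further zeros, up to a possibly nonstandard power.  They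
    are the states reached by finitely many zeros: this property of powers is
    bounded and inherited from [d] to [k d], and the comprehension scheme gives
    induction along the powers for such properties ([power_ind]), because the
    lowest nonzero digit of a number [x] sits at [V x].

    Every axiom of [Tk] is the universal closure of a bounded formula, so [Tk]
    is its own [Pi1] axiomatization. *)

Set Implicit Arguments.
Unset Strict Implicit.
Unset Printing Implicit Defensive.

Local Open Scope fol_scope.

(** * Substitution *)

Lemma tsubst_ext s1 s2 t :
  (forall n, n < tbound t -> s1 n = s2 n) -> tsubst s1 t = tsubst s2 t.
Proof.
elim: t => [n|//|t IH|t IHt u IHu|t IH] /= e12.
- exact: e12.
- by rewrite IH.
- by rewrite IHt ?IHu // => n lt_n; apply: e12; rewrite leq_max lt_n ?orbT.
- by rewrite IH.
Qed.

Lemma fsubst_ext s1 s2 A :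
  (forall n, n < fbound A -> s1 n = s2 n) -> fsubst s1 A = fsubst s2 A.
Proof.
elim: A s1 s2 => [|s t|s t|A IHA B IHB|A IHA B IHB|A IHA B IHB|A IH|A IH]
  s1 s2 //= e12.
1,2: by rewrite (tsubst_ext (s2 := s2)) ?(@tsubst_ext s1 s2 t) // => n lt_n;
  apply: e12; rewrite leq_max lt_n ?orbT.
1-3: by rewrite (IHA s1 s2) ?(IHB s1 s2) // => n lt_n;
  apply: e12; rewrite leq_max lt_n ?orbT.
all: rewrite (IH (up s1) (up s2)) // => -[//|n] lt_n /=.
all: by rewrite e12 //; move: lt_n; case: (fbound A).
Qed.

Lemma tsubst_id t : tsubst TVar t = t.
Proof. by elim: t => //= [t ->|t -> u ->|t ->]. Qed.

Lemma up_id : up TVar = TVar.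
Proof. by apply: functional_extensionality => -[]. Qed.

Lemma fsubst_id A : fsubst TVar A = A.
Proof.
elim: A => [|s t|s t|A IHA B IHB|A IHA B IHB|A IHA B IHB|A IH|A IH] //=;
by rewrite ?up_id ?tsubst_id ?IHA ?IHB ?IH.
Qed.

Lemma fsubst_sentence s A : sentence A -> fsubst s A = A.
Proof.
by move=> clA; rewrite -[RHS]fsubst_id; apply: fsubst_ext => n; rewrite clA.
Qed.

Lemma tsubst_comp s2 s1 t :
  tsubst s2 (tsubst s1 t) = tsubst (fun n => tsubst s2 (s1 n)) t.
Proof. by elim: t => //= [t ->|t -> u ->|t ->]. Qed.

Lemma tsubst_up_shift s t : tsubst (up s) (tshift t) = tshift (tsubst s t).
Proof. by rewrite /tshift !tsubst_comp. Qed.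

Lemma up_comp s2 s1 :
  (fun n => tsubst (up s2) (up s1 n)) = up (fun n => tsubst s2 (s1 n)).
Proof.
by apply: functional_extensionality => -[|n] //=; rewrite tsubst_up_shift.
Qed.

Lemma fsubst_comp s2 s1 A :
  fsubst s2 (fsubst s1 A) = fsubst (fun n => tsubst s2 (s1 n)) A.
Proof.
elim: A s1 s2 => [|s t|s t|A IHA B IHB|A IHA B IHB|A IHA B IHB|A IH|A IH]
  s1 s2 //=; by rewrite ?tsubst_comp ?IHA ?IHB ?IH ?up_comp.
Qed.

Lemma fsubst_up_shift s A : fsubst (up s) (fshift A) = fshift (fsubst s A).
Proof. by rewrite /fshift !fsubst_comp. Qed.

Lemma map_fsubst_up_shift s G :
  map (fsubst (up s)) (map fshift G) = map fshift (map (fsubst s) G).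
Proof. by rewrite -!map_comp; apply: eq_map => A /=; rewrite fsubst_up_shift. Qed.

Lemma finst_up s A t :
  finst (fsubst (up s) A) t = fsubst (fun n => if n is m.+1 then s m else t) A.
Proof.
rewrite /finst fsubst_comp; congr fsubst.
apply: functional_extensionality => -[|n] //=.
by rewrite /tshift tsubst_comp tsubst_id.
Qed.

Lemma fsubst_finst s A t :
  fsubst s (finst A t) = finst (fsubst (up s) A) (tsubst s t).
Proof.
by rewrite finst_up /finst fsubst_comp; congr fsubst;
  apply: functional_extensionality => -[].
Qed.

Lemma tinst_shift u t :
  tsubst (fun n => if n is m.+1 then #m else u) (tshift t) = t.
Proof. by rewrite /tshift tsubst_comp tsubst_id. Qed.

Lemma Delta0_subst s A : Delta0 A -> Delta0 (fsubst s A).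
Proof.
move=> D0A; elim: {A}D0A s => /=; try by constructor; auto.
all: by move=> t A _ IH s; rewrite tsubst_up_shift; constructor.
Qed.

(** * Semantics of substitution, and soundness *)

Section Semantics.
Variable M : structure.
Implicit Types rho : nat -> M.

Lemma teval_subst rho s t :
  teval rho (tsubst s t) = teval (fun n => teval rho (s n)) t.
Proof. by elim: t => //= [t ->|t -> u ->|t ->]. Qed.

Lemma teval_shift a rho t : teval (scons a rho) (tshift t) = teval rho t.
Proof. by rewrite /tshift teval_subst. Qed.

Lemma teval_up a rho s :
  (fun n => teval (scons a rho) (up s n)) =
  scons a (fun n => teval rho (s n)).
Proof.
by apply: functional_extensionality => -[|n] //=; rewrite teval_shift.
Qed.

Lemma sat_subst rho s A :
  sat rho (fsubst s A) <-> sat (fun n => teval rho (s n)) A.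
Proof.
elim: A rho s => [|t u|t u|A IHA B IHB|A IHA B IHB|A IHA B IHB|A IH|A IH]
  rho s /=; rewrite ?teval_subst //.
1-3: by move: (IHA rho s) (IHB rho s); tauto.
- by split=> satA a; have := IH (scons a rho) (up s); rewrite teval_up;
    move=> [h h']; auto.
- by split=> -[a satA]; exists a; have := IH (scons a rho) (up s);
    rewrite teval_up; move=> [h h']; auto.
Qed.

Lemma sat_shift a rho A : sat (scons a rho) (fshift A) <-> sat rho A.
Proof. exact: sat_subst. Qed.

Lemma sat_finst rho A t :
  sat rho (finst A t) <-> sat (scons (teval rho t) rho) A.
Proof.
rewrite /finst sat_subst.
suff -> : (fun n => teval rho (if n is m.+1 then #m else t)) =
          scons (teval rho t) rho by [].
by apply: functional_extensionality => -[].
Qed.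

Lemma sat_sentence rho1 rho2 A : sentence A -> sat rho1 A -> sat rho2 A.
Proof.
move=> clA; rewrite -(fsubst_sentence (fun _ => TZero) clA).
by rewrite !sat_subst.
Qed.

Lemma soundness G A :
  prv G A -> forall rho, (forall B, List.In B G -> sat rho B) -> sat rho A.
Proof.
have shiftG a rho G' : (forall B, List.In B G' -> sat rho B) ->
    forall B, List.In B (map fshift G') -> sat (scons a rho) B.
  by move=> satG B /List.in_map_iff [C [<- inC]]; rewrite sat_shift; apply: satG.
elim=> {G A}.
- by move=> G A inA rho satG; apply: satG.
- move=> G A _ IH rho satG; apply: NNPP => nA; apply: (IH rho) => B /= [<- //|].
  exact: satG.
- by move=> G A B _ IHA _ IHB rho satG /=; auto.
- by move=> G A B _ IH rho satG; have [] := IH rho satG.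
- by move=> G A B _ IH rho satG; have [] := IH rho satG.
- by move=> G A B _ IH rho satG; left; apply: IH.
- by move=> G A B _ IH rho satG; right; apply: IH.
- move=> G A B C _ IH _ IHA _ IHB rho satG; case: (IH rho satG) => h.
    by apply: IHA => D /= [<- //|]; apply: satG.
  by apply: IHB => D /= [<- //|]; apply: satG.
- by move=> G A B _ IH rho satG h; apply: IH => D /= [<- //|]; apply: satG.
- by move=> G A B _ IHAB _ IHA rho satG; apply: (IHAB rho satG); apply: IHA.
- by move=> G A _ IH rho satG a; apply: IH; apply: shiftG.
- by move=> G A t _ IH rho satG; rewrite sat_finst; apply: (IH rho satG).
- by move=> G A t _ IH rho satG; exists (teval rho t); rewrite -sat_finst;
  apply: IH.
- move=> G A C _ IHA _ IHC rho satG; have [a satA] := IHA rho satG.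
  rewrite -(sat_shift a); apply: IHC => D /= [<- //|]; exact: shiftG.
- by [].
- move=> G A s t _ IHe _ IHA rho satG; have := IHA rho satG.
  by rewrite !sat_finst; have /= -> := IHe rho satG.
Qed.

Lemma models_all A : models M (FAll A) <-> models M A.
Proof.
split=> mA rho; last by move=> a; apply: mA.
have -> : rho = scons (rho 0) (fun n => rho n.+1).
  by apply: functional_extensionality => -[].
exact: mA.
Qed.

Lemma models_uclosure A : models M (uclosure A) <-> models M A.
Proof.
rewrite /uclosure; elim: (fbound A) => [//|n IH] /=.
by rewrite models_all.
Qed.

End Semantics.

(** * Completeness *)

Lemma prv_weaken G G' A : prv G A -> List.incl G G' -> prv G' A.
Proof.
move=> pA; have cons_incl X K K' : List.incl K K' -> List.incl (X :: K) (X :: K').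
  by move=> s B /= [->|/s]; auto.
have map_incl K K' : List.incl K K' -> List.incl (map fshift K) (map fshift K').
  by move=> s B /List.in_map_iff [C [<- /s inC]]; apply: List.in_map.
elim: pA G' => {G A}.
- by move=> G A inA G' s; apply: prv_Hyp; apply: s.
- by move=> G A _ IH G' s; apply: prv_RAA; apply: IH; apply: cons_incl.
- by move=> G A B _ IHA _ IHB G' s; apply: prv_AndI; auto.
- by move=> G A B _ IH G' s; apply: prv_AndE1 (IH _ s).
- by move=> G A B _ IH G' s; apply: prv_AndE2 (IH _ s).
- by move=> G A B _ IH G' s; apply: prv_OrI1; auto.
- by move=> G A B _ IH G' s; apply: prv_OrI2; auto.
- by move=> G A B C _ IH _ IHA _ IHB G' s; apply: (prv_OrE (IH _ s)); auto.
- by move=> G A B _ IH G' s; apply: prv_ImpI; auto.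
- by move=> G A B _ IHAB _ IHA G' s; apply: prv_ImpE (IHAB _ s) (IHA _ s).
- by move=> G A _ IH G' s; apply: prv_AllI; auto.
- by move=> G A t _ IH G' s; apply: prv_AllE; auto.
- by move=> G A t _ IH G' s; apply: prv_ExI (IH _ s).
- by move=> G A C _ IHA _ IHC G' s; apply: (prv_ExE (IHA _ s)); auto.
- by move=> G t G' s; apply: prv_EqI.
- by move=> G A s t _ IHe _ IHA G' sG; apply: prv_EqE (IHe _ sG) (IHA _ sG).
Qed.

Lemma prv_subst G A :
  prv G A -> forall s, prv (map (fsubst s) G) (fsubst s A).
Proof.
elim=> {G A} /=.
- by move=> G A inA s; apply: prv_Hyp; apply: List.in_map.
- by move=> G A _ IH s; apply: prv_RAA; apply: IH.
- by move=> G A B _ IHA _ IHB s; apply: prv_AndI.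
- by move=> G A B _ IH s; apply: prv_AndE1 (IH s).
- by move=> G A B _ IH s; apply: prv_AndE2 (IH s).
- by move=> G A B _ IH s; apply: prv_OrI1.
- by move=> G A B _ IH s; apply: prv_OrI2.
- by move=> G A B C _ IH _ IHA _ IHB s; apply: (prv_OrE (IH s)).
- by move=> G A B _ IH s; apply: prv_ImpI.
- by move=> G A B _ IHAB _ IHA s; apply: prv_ImpE (IHAB s) (IHA s).
- by move=> G A _ IH s; apply: prv_AllI; rewrite -map_fsubst_up_shift.
- by move=> G A t _ IH s; rewrite fsubst_finst; apply: prv_AllE.
- move=> G A t _ IH s; apply: (@prv_ExI _ _ (tsubst s t)).
  by rewrite -fsubst_finst.
- move=> G A C _ IHA _ IHC s; apply: (prv_ExE (IHA s)).
  by rewrite -map_fsubst_up_shift -fsubst_up_shift; apply: IHC.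
- by move=> G t s; apply: prv_EqI.
- move=> G A t u _ IHe _ IHA s; rewrite fsubst_finst.
  by apply: (prv_EqE (IHe s)); rewrite -fsubst_finst.
Qed.

Fixpoint tcode (t : term) : GenTree.tree nat :=
  match t with
  | TVar n => GenTree.Leaf n
  | TZero => GenTree.Node 0 [::]
  | TSucc u => GenTree.Node 1 [:: tcode u]
  | TAdd u v => GenTree.Node 2 [:: tcode u; tcode v]
  | TV u => GenTree.Node 3 [:: tcode u]
  end.

Fixpoint tdecode (x : GenTree.tree nat) : term :=
  match x with
  | GenTree.Leaf n => TVar n
  | GenTree.Node 1 [:: u] => TSucc (tdecode u)
  | GenTree.Node 2 [:: u; v] => TAdd (tdecode u) (tdecode v)
  | GenTree.Node 3 [:: u] => TV (tdecode u)
  | _ => TZero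
  end.

Lemma tcodeK : cancel tcode tdecode.
Proof. by elim=> //= [t ->|t -> u ->|t ->]. Qed.

Fixpoint fcode (A : form) : GenTree.tree nat :=
  match A with
  | FBot => GenTree.Node 0 [::]
  | FEq s t => GenTree.Node 1 [:: tcode s; tcode t]
  | FLe s t => GenTree.Node 2 [:: tcode s; tcode t]
  | FAnd B C => GenTree.Node 3 [:: fcode B; fcode C]
  | FOr B C => GenTree.Node 4 [:: fcode B; fcode C]
  | FImp B C => GenTree.Node 5 [:: fcode B; fcode C]
  | FAll B => GenTree.Node 6 [:: fcode B]
  | FEx B => GenTree.Node 7 [:: fcode B]
  end.

Fixpoint fdecode (x : GenTree.tree nat) : form :=
  match x with
  | GenTree.Node 1 [:: s; t] => FEq (tdecode s) (tdecode t)
  | GenTree.Node 2 [:: s; t] => FLe (tdecode s) (tdecode t)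
  | GenTree.Node 3 [:: B; C] => FAnd (fdecode B) (fdecode C)
  | GenTree.Node 4 [:: B; C] => FOr (fdecode B) (fdecode C)
  | GenTree.Node 5 [:: B; C] => FImp (fdecode B) (fdecode C)
  | GenTree.Node 6 [:: B] => FAll (fdecode B)
  | GenTree.Node 7 [:: B] => FEx (fdecode B)
  | _ => FBot
  end.

Lemma fcodeK : cancel fcode fdecode.
Proof.
by elim=> //= [s t|s t|A -> B ->|A -> B ->|A -> B ->|A ->|A ->] //; rewrite !tcodeK.
Qed.

Definition enum_form (n : nat) : form :=
  if unpickle n is Some x then fdecode x else FBot.

Lemma enum_form_onto A : exists n, enum_form n = A.
Proof. by exists (pickle (fcode A)); rewrite /enum_form pickleK fcodeK. Qed.

(** Since the axioms are sentences, the variables are free to serve as Henkin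
    constants, and one enumeration can both complete a finite set of formulas
    and supply witnesses. *)
Section Henkin.
Variable T : theory.
Hypothesis clT : forall A, T A -> sentence A.

(** [T] may be infinite, hence contexts are finite sets of further
    hypotheses, in which free variables are allowed. *)
Definition derives (G : seq form) (A : form) : Prop :=
  exists2 K, (forall B, List.In B K -> T B) & prv (K ++ G) A.

Definition consistent G := ~ derives G FBot.

Lemma derives_prv G A : prv G A -> derives G A.
Proof. by move=> pA; exists [::]. Qed.

Lemma derives_weaken G G' A : derives G A -> List.incl G G' -> derives G' A.
Proof.
move=> [K TK pA] s; exists K => //; apply: prv_weaken pA _ => B.
by rewrite !List.in_app_iff => -[]; auto.
Qed.

Lemma derives_imp G A B : derives (A :: G) B -> derives G (A ->' B).
Proof.
move=> [K TK pB]; exists K => //; apply: prv_ImpI.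
apply: prv_weaken pB _ => C /=.
rewrite !List.in_app_iff /=; tauto.
Qed.

Lemma derives_mp G A B : derives G (A ->' B) -> derives G A -> derives G B.
Proof.
move=> [K TK pAB] [K' TK' pA]; exists (K ++ K').
  by move=> C; rewrite List.in_app_iff => -[]; auto.
by apply: (@prv_ImpE _ A); [apply: prv_weaken pAB _|apply: prv_weaken pA _] => C;
  rewrite !List.in_app_iff; tauto.
Qed.

Definition gbound (G : seq form) := \max_(A <- G) fbound A.

Lemma gbound_in G A : List.In A G -> fbound A <= gbound G.
Proof.
rewrite /gbound; elim: G => [//|B G IH] /=; rewrite big_cons leq_max.
by move=> [->|/IH ->]; rewrite ?leqnn ?orbT.
Qed.

(** The substitution sending the fresh variable to the eigenvariable [#0] and
    shifting all others turns a refutation using the witness into one to which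
    existential elimination applies. *)
Lemma consistent_witness B G :
  consistent (FEx B :: G) ->
  consistent (finst B #(gbound (FEx B :: G)) :: FEx B :: G).
Proof.
set v := gbound _ => con [K TK p]; apply: con.
pose s n := if n == v then #0 else #(n.+1).
have s_lt n : n < v -> s n = #(n.+1) by rewrite /s => lt_n; rewrite ltn_eqF.
have sK A : List.In A (K ++ FEx B :: G) -> fsubst s A = fshift A.
  move=> inA; apply: fsubst_ext => n lt_n; apply: s_lt; apply: leq_trans lt_n _.
  move: inA; rewrite List.in_app_iff => -[/TK/clT -> //|]; exact: gbound_in.
have sB : fsubst s (finst B #v) = B.
  rewrite /finst fsubst_comp -[RHS]fsubst_id; apply: fsubst_ext => -[|n] lt_n /=.
    by rewrite /s eqxx.
  apply: s_lt; have := @gbound_in (FEx B :: G) (FEx B) (or_introl erefl).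
  by apply: leq_trans => /=; case: (fbound B) lt_n.
exists K => //; apply: (@prv_ExE _ B).
  by apply: prv_Hyp; rewrite List.in_app_iff; right; left.
have := prv_subst p s => /=; move/prv_weaken; apply => A.
move=> /List.in_map_iff [C [<-]]; rewrite List.in_app_iff /= => inC.
have [<-|inC'] : finst B #v = C \/ List.In C (K ++ FEx B :: G).
- by rewrite List.in_app_iff /=; tauto.
- by left; rewrite sB.
- by right; rewrite sK //; apply: List.in_map.
Qed.

Variable G0 : seq form.
Hypothesis conG0 : consistent G0.

(** The witness is a variable beyond all those used so far; it is available
    because a stage is finite. *)
Fixpoint stage (n : nat) : seq form :=
  if n is m.+1 then
    let A := enum_form m in
    if excluded_middle_informative (consistent (A :: stage m)) then
      if A is FEx B then finst B #(gbound (A :: stage m)) :: A :: stage m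
      else A :: stage m
    else stage m
  else G0.

Lemma stage_consistent n : consistent (stage n).
Proof.
elim: n => [//|n IH] /=; case: (excluded_middle_informative _) => //.
by case: (enum_form n) => // B; apply: consistent_witness.
Qed.

Lemma stageS n : List.incl (stage n) (stage n.+1).
Proof.
move=> A inA /=; case: (excluded_middle_informative _) => ? //=.
by case: (enum_form n) => [|? ?|? ?|? ?|? ?|? ?|?|?]; do ?right.
Qed.

Lemma stage_mono m n : m <= n -> List.incl (stage m) (stage n).
Proof.
move=> /subnK <-; elim: (n - m) => [//|d IH] A /IH; exact: stageS.
Qed.

Definition limit (A : form) : Prop := exists n, List.In A (stage n).

Lemma limit_finite G :
  (forall B, List.In B G -> limit B) -> exists n, List.incl G (stage n).
Proof.
elim: G => [|B G IH] limG; first by exists 0.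
have [n sG] := IH (fun C inC => limG C (or_intror inC)).
have [m inB] := limG B (or_introl erefl).
exists (maxn m n) => C /= [<-|/sG].
  by apply: stage_mono inB; rewrite leq_maxl.
by apply: stage_mono; rewrite leq_maxr.
Qed.

Lemma limit_enum n :
  consistent (enum_form n :: stage n) -> List.In (enum_form n) (stage n.+1).
Proof.
move=> con /=; case: (excluded_middle_informative _) => ? //=.
by case: (enum_form n) => [|? ?|? ?|? ?|? ?|? ?|?|?]; do ?[by left|right].
Qed.

(** At its turn in the enumeration [A] cannot have been refused, for then it
    would refute a later stage that derives it. *)
Lemma limit_closed G A :
  (forall B, List.In B G -> limit B) -> derives G A -> limit A.
Proof.
move=> /limit_finite [m sG] dA; have [n eA] := enum_form_onto A.
exists n.+1; rewrite -eA; apply: limit_enum => dF.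
apply: (@stage_consistent (maxn m n)); apply: (@derives_mp _ A).
  apply: derives_imp; rewrite -eA; apply: derives_weaken dF _.
  by move=> B /= [->|inB]; [left|right; apply: stage_mono inB; rewrite leq_maxr].
apply: derives_weaken dA _ => B /sG; apply: stage_mono; exact: leq_maxl.
Qed.

Lemma limit_prv G A : prv G A -> (forall B, List.In B G -> limit B) -> limit A.
Proof. by move=> pA limG; apply: limit_closed limG _; apply: derives_prv. Qed.

Lemma limit_theory A : T A -> limit A.
Proof.
move=> TA; apply: (@limit_closed [::]) => //; exists [:: A] => [B /= [<-|]//|].
by apply: prv_Hyp; left.
Qed.

Lemma limit_bot : ~ limit FBot.
Proof.
move=> [n inF]; apply: (@stage_consistent n); apply: derives_prv.
exact: prv_Hyp.
Qed.

Lemma limit_not A : limit (~' A) <-> ~ limit A.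
Proof.
split=> [lnA lA|nlA].
  apply: limit_bot; apply: (@limit_prv [:: ~' A; A]).
    by apply: (@prv_ImpE _ A); apply: prv_Hyp => /=; auto.
  by move=> B /= [<-|[<-|]].
have [n eA] := enum_form_onto A.
apply: (@limit_closed (stage n)); first by move=> B inB; exists n.
apply: derives_imp; apply: NNPP => con; apply: nlA.
by exists n.+1; rewrite -eA; apply: limit_enum; rewrite eA.
Qed.

Lemma limit_and A B : limit (A /\' B) <-> limit A /\ limit B.
Proof.
split=> [lAB|[lA lB]].
  by split; apply: (@limit_prv [:: A /\' B]) => [|C /= [<-|]] //;
    [apply: (@prv_AndE1 _ _ B)|apply: (@prv_AndE2 _ A)]; apply: prv_Hyp; left.
apply: (@limit_prv [:: A; B]); last by move=> C /= [<-|[<-|]].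
by apply: prv_AndI; apply: prv_Hyp => /=; auto.
Qed.

Lemma limit_imp A B : limit (A ->' B) <-> (limit A -> limit B).
Proof.
split=> [lAB lA|lAB].
  apply: (@limit_prv [:: A ->' B; A]); last by move=> C /= [<-|[<-|]].
  by apply: (@prv_ImpE _ A); apply: prv_Hyp => /=; auto.
case: (classic (limit A)) => [/lAB lB|/limit_not nlA].
  apply: (@limit_prv [:: B]); last by move=> C /= [<-|].
  by apply: prv_ImpI; apply: prv_Hyp => /=; auto.
apply: (@limit_prv [:: ~' A]); last by move=> C /= [<-|].
apply: prv_ImpI; apply: prv_RAA; apply: (@prv_ImpE _ A); apply: prv_Hyp => /=; auto.
Qed.

Lemma limit_or A B : limit (A \/' B) <-> limit A \/ limit B.
Proof.
split=> [lAB|[lA|lB]]; last 2 first.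
- apply: (@limit_prv [:: A]); last by move=> C /= [<-|].
  by apply: prv_OrI1; apply: prv_Hyp => /=; auto.
- apply: (@limit_prv [:: B]); last by move=> C /= [<-|].
  by apply: prv_OrI2; apply: prv_Hyp => /=; auto.
apply: NNPP => /not_or_and [/limit_not lnA /limit_not lnB].
apply: limit_bot; apply: (@limit_prv [:: A \/' B; ~' A; ~' B]).
  apply: (@prv_OrE _ A B); first by apply: prv_Hyp => /=; auto.
    by apply: (@prv_ImpE _ A); apply: prv_Hyp => /=; auto.
  by apply: (@prv_ImpE _ B); apply: prv_Hyp => /=; auto.
by move=> C /= [<-|[<-|[<-|]]].
Qed.

Lemma limit_ex A : limit (FEx A) <-> exists t, limit (finst A t).
Proof.
split=> [lA|[t lA]]; last first.
  apply: (@limit_prv [:: finst A t]); last by move=> C /= [<-|].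
  by apply: (@prv_ExI _ _ t); apply: prv_Hyp; left.
have [n eA] := enum_form_onto (FEx A).
have con : consistent (enum_form n :: stage n).
  rewrite eA => dF; have [m inA] := lA.
  apply: (@stage_consistent (maxn m n)); apply: derives_weaken dF _.
  move=> B /= [<-|]; first by apply: stage_mono inA; rewrite leq_maxl.
  by apply: stage_mono; rewrite leq_maxr.
exists #(gbound (FEx A :: stage n)), n.+1 => /=.
by case: (excluded_middle_informative _) => //; rewrite eA; left.
Qed.

Lemma limit_all A : limit (FAll A) <-> forall t, limit (finst A t).
Proof.
split=> [lA t|lA].
  apply: (@limit_prv [:: FAll A]); last by move=> C /= [<-|].
  by apply: prv_AllE; apply: prv_Hyp; left.
apply: NNPP => /limit_not nlA.
have /limit_ex [t] : limit (FEx (~' A)).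
  apply: (@limit_prv [:: ~' (FAll A)]); last by move=> C /= [<-|].
  apply: prv_RAA; apply: (@prv_ImpE _ (FAll A)); first by apply: prv_Hyp => /=;
    auto.
  apply: prv_AllI; apply: prv_RAA.
  apply: (@prv_ImpE _ (fshift (FEx (~' A)))); first by apply: prv_Hyp => /=; auto.
  apply: (@prv_ExI _ _ #0).
  rewrite -/(fshift _) -[finst _ _]/(~' (finst (fsubst (up _) A) #0)) finst_up.
  have -> : (fun n => if n is m.+1 then #(m.+1) else #0) = TVar.
    by apply: functional_extensionality => -[].
  by rewrite fsubst_id; apply: prv_Hyp; left.
by move/(@limit_not (finst A t)); apply.
Qed.

Definition teq s t := limit (s =' t).

Lemma teq_refl t : teq t t.
Proof. by apply: (@limit_prv [::]) => //; apply: prv_EqI. Qed.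

Lemma teq_rewrite A s t : teq s t -> limit (finst A s) -> limit (finst A t).
Proof.
move=> est lA; apply: (@limit_prv [:: s =' t; finst A s]).
  by apply: (@prv_EqE _ A s t); apply: prv_Hyp => /=; auto.
by move=> C /= [<-|[<-|]].
Qed.

Lemma teq_sym s t : teq s t -> teq t s.
Proof.
move=> est; have := @teq_rewrite (#0 =' tshift s) s t est.
by rewrite /finst /= !tinst_shift; apply; apply: teq_refl.
Qed.

Lemma teq_trans s t u : teq s t -> teq t u -> teq s u.
Proof.
move=> est etu; have := @teq_rewrite (tshift s =' #0) t u etu.
by rewrite /finst /= !tinst_shift; apply.
Qed.

Lemma teq_fun (f : term -> term) s t :
    (exists g, forall u,
       tsubst (fun n => if n is m.+1 then #m else u) g = f u) ->
  teq s t -> teq (f s) (f t).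
Proof.
move=> [g eg] est; have := @teq_rewrite (tshift (f s) =' g) s t est.
by rewrite /finst /= !tinst_shift !eg; apply; apply: teq_refl.
Qed.

Lemma teq_add s s' t t' : teq s s' -> teq t t' -> teq (s +' t) (s' +' t').
Proof.
move=> es et; apply: (@teq_trans _ (s' +' t)).
  apply: (@teq_fun (fun u => u +' t)) es.
  by exists (#0 +' tshift t) => u /=; rewrite tinst_shift.
apply: (@teq_fun (fun u => s' +' u)) et.
by exists (tshift s' +' #0) => u /=; rewrite tinst_shift.
Qed.

Lemma limit_le s s' t t' :
  teq s s' -> teq t t' -> limit (s <=' t) -> limit (s' <=' t').
Proof.
move=> es et lst; have := @teq_rewrite (tshift s' <=' #0) t t' et.
rewrite /finst /= !tinst_shift; apply.
have := @teq_rewrite (#0 <=' tshift t) s s' es.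
by rewrite /finst /= !tinst_shift; apply.
Qed.

(** Equality is interpreted by identity, so the elements of the model are the
    chosen representatives of the classes of provably equal terms. *)
Definition rep (t : term) : term := epsilon (inhabits TZero) (teq t).

Lemma teq_rep t : teq t (rep t).
Proof. by apply: epsilon_spec; exists t; apply: teq_refl. Qed.

Lemma rep_eq s t : teq s t -> rep s = rep t.
Proof.
move=> est; rewrite /rep; congr epsilon; apply: functional_extensionality => u.
by apply: propositional_extensionality; split; apply: teq_trans => //;
  apply: teq_sym.
Qed.

Definition cls (t : term) : {t : term | rep t = t} :=
  exist _ (rep t) (esym (rep_eq (teq_rep t))).

Lemma clsP s t : cls s = cls t <-> teq s t.
Proof.
split=> [[e]|/rep_eq e]; last first.
  apply: eq_sig_hprop => //= u; exact: proof_irrelevance.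
apply: teq_trans (teq_rep s) _; rewrite e; exact/teq_sym/teq_rep.
Qed.

Lemma cls_val (x : {t : term | rep t = t}) : cls (sval x) = x.
Proof. by apply: eq_sig_hprop => [u|];
  [exact: proof_irrelevance|exact: (svalP x)]. Qed.

Definition term_model : structure :=
  @Structure {t : term | rep t = t} (cls TZero)
    (fun x => cls (TSucc (sval x)))
    (fun x y => cls (sval x +' sval y))
    (fun x => cls (TV (sval x)))
    (fun x y => limit (sval x <=' sval y)).

Lemma teval_term_model s t :
  teval (M := term_model) (fun n => cls (s n)) t = cls (tsubst s t).
Proof.
elim: t => //= [t ->|t -> u ->|t ->]; apply/clsP.
- apply: (@teq_fun TSucc); first by exists (TSucc #0).
  exact/teq_sym/teq_rep.
- by apply: teq_add; apply/teq_sym/teq_rep.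
- apply: (@teq_fun TV); first by exists (TV #0).
  exact/teq_sym/teq_rep.
Qed.

Lemma scons_cls (x : term_model) s :
  scons x (fun n => cls (s n) : term_model) =
  fun n => cls (if n is m.+1 then s m else sval x).
Proof. by apply: functional_extensionality => -[|n] //=; rewrite cls_val. Qed.

(** The valuations of the model are the substitutions up to provable equality;
    the statement for all of them makes the quantifier cases go through. *)
Lemma truth s A :
  sat (M := term_model) (fun n => cls (s n)) A <-> limit (fsubst s A).
Proof.
elim: A s => [|t u|t u|A IHA B IHB|A IHA B IHB|A IHA B IHB|A IH|A IH] s /=.
- by split=> // /limit_bot.
- by rewrite !teval_term_model clsP.
- rewrite !teval_term_model /=; split; apply: limit_le;
    do ?exact: teq_rep; exact/teq_sym/teq_rep.
- by rewrite limit_and IHA IHB.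
- by rewrite limit_or IHA IHB.
- by rewrite limit_imp IHA IHB.
- rewrite limit_all; split=> lA t.
    have := lA (cls t); rewrite scons_cls IH finst_up.
    have := lA (cls t).
    suff -> : scons (cls t : term_model) (fun n => cls (s n)) =
        fun n => cls (if n is m.+1 then s m else t) by rewrite IH.
    by apply: functional_extensionality => -[|n].
  by rewrite scons_cls IH -finst_up.
- rewrite limit_ex; split=> [[x]|[t]].
    by rewrite scons_cls IH -finst_up; exists (sval x).
  rewrite finst_up -IH => h; exists (cls t).
  suff -> : scons (cls t : term_model) (fun n => cls (s n)) =
      fun n => cls (if n is m.+1 then s m else t) by [].
  by apply: functional_extensionality => -[|n].
Qed.

Lemma term_model_models A : T A -> models term_model A.
Proof.
move=> TA rho; have -> : rho = fun n => cls (sval (rho n)).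
  by apply: functional_extensionality => n; rewrite cls_val.
by rewrite truth fsubst_sentence; [apply: limit_theory|apply: clT].
Qed.

Lemma term_model_sat A :
  List.In A G0 -> sat (M := term_model) (fun n => cls #n) A.
Proof. by move=> inA; rewrite truth fsubst_id; exists 0. Qed.

End Henkin.

Theorem completeness (T : theory) (A : form) :
    (forall B, T B -> sentence B) -> sentence A ->
    (forall M : structure, (forall B, T B -> models M B) -> models M A) ->
  T |-' A.
Proof.
move=> clT clA sem; apply: NNPP => nA.
have con : consistent T [:: ~' A].
  move=> [K TK pF]; apply: nA; exists K => //; apply: prv_RAA.
  by apply: prv_weaken pF _ => B; rewrite List.in_app_iff /=; tauto.
have mA := sem _ (@term_model_models T clT _ con).
exact: (@term_model_sat T clT _ con _ (or_introl erefl)) (mA _).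
Qed.

(** * The standard model *)

Section Standard.
Variable k : nat.
Hypothesis hk : 2 <= k.

(** The decomposition [k ^ i * m] with [m] not divisible by [k] replaces the
    maximum in the definition of [Vnat] in what follows. *)
Lemma kdiv_decomp x : 0 < x -> exists i m, x = k ^ i * m /\ ~~ (k %| m).
Proof.
elim/ltn_ind: x => x IH x_gt0.
case: (boolP (k %| x)) => [/dvdnP [y ex]|ndvd]; last by exists 0, x; rewrite mul1n.
have y_gt0 : 0 < y by move: x_gt0; rewrite ex; case: (y).
have [|i [m [ey ndvd]]] := IH y _ y_gt0; first by rewrite ex ltn_Pmulr.
by exists i.+1, m; rewrite ex ey expnS; split=> //; rewrite mulnC mulnA.
Qed.

Lemma Vnat_decomp i m : ~~ (k %| m) -> Vnat k (k ^ i * m) = k ^ i.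
Proof.
move=> ndvd; have m_gt0 : 0 < m by case: m ndvd => //; rewrite dvdn0.
have k_gt0 : 0 < k by lia.
have ki_gt0 : 0 < k ^ i by rewrite expn_gt0 k_gt0.
rewrite /Vnat muln_eq0 !eqn0Ngt ki_gt0 m_gt0 /=.
have lt_i : i < (k ^ i * m).+1.
  by rewrite ltnS (leq_trans (ltnW (ltn_expl i hk))) // leq_pmulr.
apply/eqP; rewrite eqn_leq; apply/andP; split.
  apply/bigmax_leqP => j /= dvd_j; rewrite leq_exp2l // leqNgt.
  apply: contra ndvd => lt_ij; rewrite -(@dvdn_pmul2l (k ^ i)) // -expnSr.
  by apply: dvdn_trans dvd_j; apply: dvdn_exp2l.
by apply: (@bigmax_sup _ (Ordinal lt_i)) => //=; apply: dvdn_mulr.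
Qed.

Lemma Vnat_exp i : Vnat k (k ^ i) = k ^ i.
Proof. by rewrite -[X in Vnat _ X]muln1 Vnat_decomp // dvdn1; lia. Qed.

Lemma Vnat_expM i x : Vnat k (k ^ i * x) = k ^ i * Vnat k x.
Proof.
case: (posnP x) => [->|/kdiv_decomp [j [m [-> ndvd]]]].
  by rewrite !muln0 (_ : Vnat k 0 = 0) ?muln0.
by rewrite mulnA -expnD !Vnat_decomp // expnD.
Qed.

(** The condition on the digits beyond position [j] in the formula [digit], as
    a divisibility. *)
Lemma Vnat_gt j z : 0 < z -> (k ^ j < Vnat k z) = (k ^ j.+1 %| z).
Proof.
move=> /kdiv_decomp [i [m [-> ndvd]]]; rewrite Vnat_decomp // ltn_exp2l //.
apply/idP/idP => [lt_ji|]; first by apply: dvdn_mulr; apply: dvdn_exp2l.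
apply: contraLR; rewrite -leqNgt => le_ij; apply: contra ndvd => dvd_m.
rewrite -(@dvdn_pmul2l (k ^ i)) ?expn_gt0 -?expnSr; last lia.
by apply: dvdn_trans dvd_m; apply: dvdn_exp2l.
Qed.

Lemma Vnat_fixed d : 0 < d -> Vnat k d = d -> exists i, d = k ^ i.
Proof.
move=> /kdiv_decomp [i [m [-> ndvd]]]; rewrite Vnat_decomp // => <-.
by exists i.
Qed.

(** Subsets of the powers of [k] below [k ^ i] are coded by sums of powers. *)
Lemma comprehension (b : nat -> bool) i :
  exists2 x, x < k ^ i & forall j, j < i ->
    exists y z, [/\ x = y + b j * k ^ j + z, y < k ^ j & k ^ j.+1 %| z].
Proof.
elim: i => [|i [x lt_x IH]]; first by exists 0.
exists (x + b i * k ^ i) => [|j].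
  have := leq_mul hk (leqnn (k ^ i)); rewrite expnS; case: (b i); lia.
rewrite ltnS leq_eqVlt => /orP [/eqP ->|lt_ji]; first by exists x, 0; rewrite addn0.
have [y [z [-> lt_y dvd_z]]] := IH j lt_ji.
exists y, (z + b i * k ^ i); split=> //; first by rewrite !addnA.
by apply: dvdn_add => //; apply: dvdn_mull; apply: dvdn_exp2l.
Qed.

Lemma teval_tnum (rho : nat -> stdmodel k) a : teval rho (tnum a) = a.
Proof. by elim: a => //= a ->. Qed.

Lemma teval_tmul (rho : nat -> stdmodel k) a t :
  teval rho (tmul a t) = (a * (teval rho t : nat))%N.
Proof. by elim: a => //= a ->; rewrite mulSn. Qed.

End Standard.

Lemma sat_bigor (M : structure) (rho : nat -> M) (r : seq nat) (F : nat -> form) :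
  sat rho (\big[FOr/FBot]_(a <- r) F a) <-> exists2 a, a \in r & sat rho (F a).
Proof.
elim: r => [|a r IH]; first by rewrite big_nil; split=> // -[].
rewrite big_cons /= IH; split=> [[satF|[b b_r satF]]|[b]].
- by exists a; rewrite ?mem_head.
- by exists b; rewrite // inE b_r orbT.
- by rewrite inE => /orP [/eqP ->|b_r] satF; [left|right; exists b].
Qed.

Lemma sat_bigand (M : structure) (rho : nat -> M) (r : seq nat) (F : nat -> form) :
  sat rho (\big[FAnd/FTop]_(a <- r) F a) <-> forall a, a \in r -> sat rho (F a).
Proof.
elim: r => [|a r IH]; first by rewrite big_nil; split=> [_ a|_ []].
rewrite big_cons /= IH; split=> [[satF sat_r] b|satF].
  by rewrite inE => /orP [/eqP ->|/sat_r].
by split=> [|b b_r]; apply: satF; rewrite inE ?eqxx ?b_r ?orbT.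
Qed.

Lemma sat_isP k (rho : nat -> stdmodel k) t :
  2 <= k -> sat rho (isP t) <-> exists i, teval rho t = k ^ i.
Proof.
move=> hk /=; split=> [[[_ nz] Vd]|[i ->]].
  by apply: Vnat_fixed => //; rewrite lt0n eq_sym; apply/eqP.
by rewrite Vnat_exp //; split=> //; split=> //; have := expn_gt0 k i; lia.
Qed.

Lemma stdmodel_Tax k A : 2 <= k -> Tax k A -> models (stdmodel k) A.
Proof.
move=> hk; have k_gt0 : 0 < k by lia.
case=> {A}.
all: try by move=> rho /=;
  move: (rho 0 : nat) (rho 1 : nat) (rho 2 : nat) => x y z; lia.
- move=> rho /=; split=> [le_xy|[z [_ <-]]]; last exact: leq_addl.
  by exists (rho 1 - rho 0); rewrite leq_subr subnK.
- move=> rho; apply/sat_bigor; exists (rho 0 %% k).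
    by rewrite mem_index_iota ltn_mod.
  exists (rho 0 %/ k : stdmodel k).
  rewrite /= !teval_shift !teval_tmul teval_tnum /=; split.
    by apply: leq_trans (leq_addr _ _); apply: leq_div.
  by left; rewrite mulnC addnC -divn_eq.
- by [].
- by move=> rho /=; have := Vnat_exp hk 0; rewrite expn0.
- move=> rho; rewrite /= !teval_tmul /=.
  by have := Vnat_expM hk 1 (rho 0); rewrite expn1.
- move=> rho /(sat_isP _ _ hk) [i /= ei]; apply/sat_bigand => a.
  rewrite mem_index_iota => lt_a; rewrite /= teval_tmul /= ei mulnC.
  by rewrite Vnat_decomp // gtnNdvd //; lia.
- move=> rho /= [[_ nx] [[_ ny] [leV neV]]].
  have x_gt0 : 0 < rho 0 by lia.
  have y_gt0 : 0 < rho 1 by lia.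
  move: leV neV.
  have [i [m [-> nm]]] := kdiv_decomp hk x_gt0.
  have [j [n [-> nn]]] := kdiv_decomp hk y_gt0.
  rewrite !Vnat_decomp // => le_ij /eqP; rewrite eqn_exp2l // => ne_ij.
  move: le_ij; rewrite leq_exp2l // => le_ij.
  rewrite -(subnKC le_ij) expnD -mulnA -mulnDr Vnat_decomp //.
  rewrite dvdn_addl // dvdn_mulr //; apply: (@dvdn_exp2l _ 1); lia.
- move=> rho /= [_ nx].
  have x_gt0 : 0 < rho 0 by lia.
  have [i [m [ex nm]]] := kdiv_decomp hk x_gt0.
  exists (k ^ i.+1 * (m %/ k))%N; split.
    rewrite /= ex expnSr -mulnA leq_mul2l mulnC; apply/orP; right.
    exact: leq_divM.
  apply/sat_bigor; exists (m %% k).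
    by rewrite mem_index_iota ltn_mod k_gt0 lt0n -/(dvdn _ _) nm.
  rewrite /= teval_tmul /= ex Vnat_decomp //; split.
    by rewrite {1}(divn_eq m k) mulnDr expnSr -mulnA (mulnC k) (mulnC (m %% k)).
  case: (posnP (m %/ k)) => [->|q_gt0]; [by right; rewrite muln0|left].
  suff : k ^ i < Vnat k (k ^ i.+1 * (m %/ k)) by lia.
  rewrite Vnat_gt ?dvdn_mulr // muln_gt0 q_gt0 expn_gt0 k_gt0 //.
- move=> rho /= [_ nx].
  have x_gt0 : 0 < rho 0 by lia.
  have lt_x := trunc_log_ltn (rho 0) hk.
  have le_x := trunc_logP hk x_gt0.
  exists (k ^ trunc_log k (rho 0))%N; split; first exact: le_x.
  split.
    by rewrite Vnat_exp //; have := expn_gt0 k (trunc_log k (rho 0)); lia.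
  rewrite /= teval_tmul /= -expnS; lia.
- move=> rho /=; case: (posnP (rho 0)) => [-> //|].
  by move=> /(kdiv_decomp hk) [i [m [-> nm]]]; rewrite Vnat_decomp // Vnat_exp.
move=> A D0A A' rho /(sat_isP _ _ hk) [i ed].
pose env x j : nat -> stdmodel k := scons (k ^ j)%N (scons x rho).
pose b j : bool := excluded_middle_informative (sat (env 0 j) A').
have bP x j : b j <-> sat (env x j) A'.
  rewrite /b; case: (excluded_middle_informative _) => h /=.
    split=> // _; move: h; rewrite !sat_subst.
    by congr sat; apply: functional_extensionality => -[].
  split=> // h'; case: h; move: h'; rewrite !sat_subst.
  by congr sat; apply: functional_extensionality => -[].
have [x lt_x digits] := comprehension hk b i.
rewrite /= in ed; exists x; split; first by rewrite /= ed; lia.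
split; first by rewrite /= ed; lia.
move=> d le_d ne_d /(sat_isP _ _ hk) [j /= ej].
rewrite /= ed in le_d ne_d.
have lt_ji : j < i by rewrite -(ltn_exp2l _ _ hk) -ej; lia.
have [y [z [ex lt_y dvd_z]]] := digits j lt_ji.
have digit_b : sat (env x j) (digit #1 #0 (b j)).
  split; first by apply/sat_isP => //; exists j.
  exists y; split=> /=; first by lia.
  split; first by lia.
  exists z; split; first by rewrite /= ex leq_addl.
  rewrite !teval_tmul /= ex; split; first by [].
  case: (posnP z) => [->|z_gt0]; first by left.
  right; have := Vnat_gt hk j z_gt0; rewrite dvd_z; lia.
rewrite ej; change (sat (env x j)
  ((digit #1 #0 1 /\' A') \/' (digit #1 #0 0 /\' ~' A'))).
move: digit_b (bP x j); case: (b j) => dig [b_A' A'_b].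
  by left; split; [exact: dig|exact: b_A'].
by right; split; [exact: dig|move/A'_b].
Qed.

Lemma stdmodel_Tk k A : 2 <= k -> Tk k A -> models (stdmodel k) A.
Proof. by move=> hk [B TB ->]; apply/models_uclosure; apply: stdmodel_Tax. Qed.

(** * Arithmetic in models *)

Definition Tk_model (k : nat) (M : structure) := forall A, Tax k A -> models M A.

Section Model.
Variables (k : nat) (hk : 2 <= k) (M : structure).
Hypothesis hM : Tk_model k M.
Implicit Types (x y z d e : M) (rho : nat -> M).

Local Notation "0" := (s_zero M).
Local Notation "x + y" := (s_add x y).
Local Notation V := (@s_V M).
Local Notation one := (s_succ 0).

Definition lt x y := s_le x y /\ x <> y.
Definition mul n x : M := iter n (s_add x) 0.
Definition power d := lt 0 d /\ V d = d.

Let env x y z : nat -> M := scons x (scons y (scons z (fun _ => x))).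

Lemma addC x y : x + y = y + x.
Proof. exact: (hM (Add_comm k) (env x y 0)). Qed.

Lemma addA x y z : x + (y + z) = x + y + z.
Proof. exact: (esym (hM (Add_assoc k) (env x y z))). Qed.

Lemma addIr z x y : x + z = y + z -> x = y.
Proof. exact: (hM (Add_cancel k) (env x y z)). Qed.

Lemma addIl z x y : z + x = z + y -> x = y.
Proof. by rewrite !(addC z); apply: addIr. Qed.

Lemma addx0 x : x + 0 = x.
Proof. exact: (hM (Add_zero k) (env x 0 0)). Qed.

Lemma add0x x : 0 + x = x.
Proof. by rewrite addC addx0. Qed.

Lemma addCA x y z : x + (y + z) = y + (x + z).
Proof. by rewrite !addA (addC x). Qed.

Lemma addACA x y z t : x + y + (z + t) = x + z + (y + t).
Proof. by rewrite -!addA (addCA y). Qed.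

Lemma lexx x : s_le x x.
Proof. exact: (hM (Le_refl k) (env x x x)). Qed.

Lemma le_anti x y : s_le x y -> s_le y x -> x = y.
Proof. exact: (hM (Le_antisym k) (env x y x)). Qed.

Lemma le_trans y x z : s_le x y -> s_le y z -> s_le x z.
Proof. exact: (hM (Le_trans k) (env x y z)). Qed.

Lemma le_total x y : s_le x y \/ s_le y x.
Proof. exact: (hM (Le_total k) (env x y x)). Qed.

Lemma le_addr z x y : s_le x y -> s_le (x + z) (y + z).
Proof. exact: (hM (Le_add k) (env x y z)). Qed.

Lemma succE x : s_succ x = x + one.
Proof. exact: (hM (Succ_add k) (env x x x)). Qed.

Lemma ltS x y : lt x y <-> s_le (s_succ x) y.
Proof. by have [h h'] := hM (Lt_succ k) (env x y x); split. Qed.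

Lemma le0x x : s_le 0 x.
Proof. exact: (hM (Ord0 k) (env x x x)). Qed.

Lemma leP x y : s_le x y <-> exists z, z + x = y.
Proof.
have [h h'] := hM (Ord1 k) (env x y x).
split=> [/h [z [_ e]]|[z e]]; first by exists z.
apply: h'; exists z; split=> //; rewrite /= -e.
by have := le_addr z (le0x x); rewrite add0x addC.
Qed.

Lemma le_addl x y : s_le x (y + x).
Proof. by apply/leP; exists y. Qed.

Lemma le_lt_trans y x z : s_le x y -> lt y z -> lt x z.
Proof.
move=> le_xy [le_yz ne]; split; first exact: le_trans le_yz.
by move=> e; apply: ne; apply: le_anti; first [exact: le_yz|rewrite -e].
Qed.

Lemma lt_le_trans y x z : lt x y -> s_le y z -> lt x z.
Proof.
move=> [le_xy ne] le_yz; split; first exact: le_trans le_yz.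
by move=> e; apply: ne; apply: le_anti; first [exact: le_xy|rewrite e].
Qed.

Lemma lt_trans y x z : lt x y -> lt y z -> lt x z.
Proof. by move=> [le_xy _]; apply: le_lt_trans. Qed.

Lemma ltxx x : ~ lt x x.
Proof. by case. Qed.

Lemma lt_or_le x y : lt x y \/ s_le y x.
Proof.
case: (classic (x = y)) => [->|ne]; first by right; apply: lexx.
by case: (le_total x y); [left|right].
Qed.

Lemma le_eq_or_lt x y : s_le x y -> x = y \/ lt x y.
Proof. by move=> le_xy; case: (classic (x = y)) => ?; [left|right]. Qed.

Lemma lt_add2l z x y : lt x y -> lt (z + x) (z + y).
Proof.
by move=> [le_xy ne]; split=> [|/addIl//]; rewrite !(addC z); apply: le_addr.
Qed.

Lemma lt_add2 x y z t : lt x y -> lt z t -> lt (x + z) (y + t).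
Proof.
move=> lt_xy lt_zt; apply: lt_trans (lt_add2l _ lt_zt) _.
by rewrite !(addC _ t); apply: lt_add2l.
Qed.

Lemma gt0P x : lt 0 x <-> x <> 0.
Proof. by split=> [[_ ne] e|ne]; [exact: ne|split; [exact: le0x|exact: nesym]]. Qed.

Lemma zero_or_gt0 x : x = 0 \/ lt 0 x.
Proof. by case: (classic (x = 0)) => [->|/gt0P]; [left|right]. Qed.

Lemma lt01 : lt 0 one.
Proof. by apply/ltS/lexx. Qed.

Lemma lt1P x : lt x one -> x = 0.
Proof.
move=> lt_x1; case: (zero_or_gt0 x) => // /ltS le1x.
by case: (@ltxx x); apply: lt_le_trans le1x.
Qed.

(** ** Multiples *)

Lemma mulS n x : mul n.+1 x = x + mul n x. Proof. by []. Qed.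

Lemma mul1 x : mul 1 x = x. Proof. exact: addx0. Qed.

Lemma muln0 n : mul n 0 = 0.
Proof. by elim: n => // n IH; rewrite mulS IH addx0. Qed.

Lemma mulD m n x : mul (m + n) x = mul m x + mul n x.
Proof. by elim: m => [|m IH]; rewrite ?add0x // addSn !mulS IH addA. Qed.

Lemma mulA m n x : mul m (mul n x) = mul (m * n) x.
Proof. by elim: m => // m IH; rewrite mulS IH mulSn mulD. Qed.

Lemma mul_lt n x y : 0 < n -> lt x y -> lt (mul n x) (mul n y).
Proof.
case: n => // n _ lt_xy; elim: n => [|n IH]; first by rewrite !mul1.
by rewrite mulS (mulS n.+1); apply: lt_add2.
Qed.

Lemma mul_inj n x y : 0 < n -> mul n x = mul n y -> x = y.
Proof.
move=> n_gt0 e; case: (lt_or_le x y) => [/(mul_lt n_gt0)|].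
  by rewrite e => /ltxx.
by move=> /le_eq_or_lt [//|/(mul_lt n_gt0)]; rewrite e => /ltxx.
Qed.

Lemma mul_leq m n x : m <= n -> s_le (mul m x) (mul n x).
Proof. by move=> /subnK <-; rewrite mulD; apply: le_addl. Qed.

Lemma lt_mul x n : lt 0 x -> 1 < n -> lt x (mul n x).
Proof.
move=> x_gt0 n_gt1; apply: (@lt_le_trans (mul 2 x)); last exact: mul_leq.
by rewrite mulS mul1 -{1}[x]addx0; apply: lt_add2l.
Qed.

Lemma le_mul x n : 0 < n -> s_le x (mul n x).
Proof. by move=> n_gt0; rewrite -{1}[x]mul1; apply: mul_leq. Qed.

(** The leading digit of a number below [mul n d] in base [d]. *)
Lemma split_lt n x d : lt x (mul n d) ->
  exists c y, [/\ c < n, lt y d & x = y + mul c d].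
Proof.
elim: n => [|n IH] lt_x.
  by case: (@ltxx 0); apply: le_lt_trans lt_x; exact: le0x.
case: (lt_or_le x (mul n d)) => [/IH [c [y [lt_c lt_y ->]]]|/leP [y ex]].
  by exists c, y; split=> //; apply: ltnW.
exists n, y; split=> //; case: (lt_or_le y d) => // le_dy.
by case: (@ltxx x); apply: lt_le_trans lt_x _; rewrite -ex; apply: le_addr.
Qed.

Lemma lt_split c n y d : c < n -> lt y d -> lt (y + mul c d) (mul n d).
Proof.
move=> lt_cn lt_yd; apply: (@lt_le_trans (mul c.+1 d)); last exact: mul_leq.
by rewrite mulS !(addC _ (mul c d)); apply: lt_add2l.
Qed.

(** ** Powers *)

Lemma teval_tmulM rho n t : teval rho (tmul n t) = mul n (teval rho t).
Proof. by elim: n => //= n ->. Qed.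

Lemma V_zero : V 0 = 0.
Proof. exact: (hM (V0_zero k) (env 0 0 0)). Qed.

Lemma V_mulk x : V (mul k x) = mul k (V x).
Proof.
by have := hM (V1_base k) (env x x x); rewrite /= !teval_tmulM.
Qed.

Lemma V_digit a d : power d -> 0 < a < k -> V (mul a d) = d.
Proof.
move=> Pd lt_a; have /= := hM (V1_digit k) (env d d d) Pd.
move/sat_bigand => /(_ a); rewrite mem_index_iota => /(_ lt_a) /=.
by rewrite teval_tmulM.
Qed.

Lemma V_add x y : lt 0 x -> lt 0 y -> lt (V x) (V y) -> V (x + y) = V x.
Proof. by move=> *; apply: (hM (V2 k) (env x y x)). Qed.

Lemma V_split x : lt 0 x -> exists a y,
  [/\ 0 < a < k, x = y + mul a (V x) & lt (V x) (V y) \/ y = 0].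
Proof.
move=> x_gt0; have /= [y [_ /sat_bigor [a]]] := hM (V3 k) (env x x x) x_gt0.
rewrite mem_index_iota => lt_a [/=]; rewrite teval_tmulM => e h.
by exists a, y; split.
Qed.

Lemma V_idem x : V (V x) = V x.
Proof. exact: (hM (V5 k) (env x x x)). Qed.

(** If [V x = 0], axiom (V3) makes [x] the rest [y] of the decomposition, which
    satisfies [V y > V x] or vanishes. *)
Lemma V_gt0 x : lt 0 x -> lt 0 (V x).
Proof.
move=> x_gt0; case: (zero_or_gt0 (V x)) => // Vx0.
have [a [y [_ ex]]] := V_split x_gt0; rewrite Vx0 muln0 addx0 in ex.
by rewrite -ex Vx0 => -[/ltxx //|x0]; move: x_gt0; rewrite x0 => /ltxx.
Qed.

Lemma V_le x : s_le (V x) x.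
Proof.
case: (zero_or_gt0 x) => [->|/V_split [a [y [/andP [a_gt0 _] ex _]]]].
  by rewrite V_zero; apply: lexx.
by rewrite {2}ex; apply: le_trans (le_addl _ y); apply: le_mul.
Qed.

Lemma power_V x : lt 0 x -> power (V x).
Proof. by move=> x_gt0; split; [apply: V_gt0|apply: V_idem]. Qed.

Lemma power1 : power one.
Proof. by split; [exact: lt01|exact: (hM (V0_one k) (env 0 0 0))]. Qed.

Lemma power_mulk d : power d -> power (mul k d).
Proof.
move=> [d_gt0 Vd]; split; last by rewrite V_mulk Vd.
by apply: (lt_trans d_gt0); apply: lt_mul.
Qed.

Lemma power_lt_mulk d : power d -> lt d (mul k d).
Proof. by move=> [d_gt0 _]; apply: lt_mul. Qed.

Lemma power_above x : exists2 d, power d & lt x d.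
Proof.
case: (zero_or_gt0 x) => [->|x_gt0].
  by exists one; [exact: power1|exact: lt01].
have /= [d [_ [Pd [_ lt_x]]]] := hM (V4 k) (env x x x) x_gt0.
exists (mul k d); first exact: power_mulk.
by move: lt_x; rewrite teval_tmulM.
Qed.

(** The value under [V] is decided by the lowest nonzero digit. *)
Lemma V_add_small x a d : lt 0 x -> lt x d -> power d -> 0 < a < k ->
  V (x + mul a d) = V x.
Proof.
move=> x_gt0 lt_x Pd lt_a; apply: V_add => //.
  by apply: (lt_le_trans (proj1 Pd)); apply: le_mul; case/andP: lt_a.
by rewrite V_digit //; apply: le_lt_trans lt_x; apply: V_le.
Qed.

(** A power strictly between [d] and [k d] would be [y + c d] with [y < d],
    whose value under [V] is less than itself. *)
Lemma power_gap d e : power d -> power e -> lt d e -> s_le (mul k d) e.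
Proof.
move=> Pd [e_gt0 Ve] lt_de; case: (lt_or_le e (mul k d)) => // lt_e.
have [c [y [lt_c lt_y ee]]] := split_lt lt_e.
have c_gt0 : 0 < c.
  case: c ee {lt_c} => // ee; case: (@ltxx d); apply: lt_trans lt_de _.
  by rewrite ee /= addx0.
case: (zero_or_gt0 y) => [y0|y_gt0].
  move: lt_de; rewrite -Ve ee y0 add0x V_digit ?c_gt0 // => /ltxx //.
case: (@ltxx e); apply: (@lt_trans d) => //.
by rewrite -Ve ee V_add_small ?c_gt0 //; apply: le_lt_trans lt_y; apply: V_le.
Qed.

Lemma V_num a : 0 < a < k -> V (mul a one) = one.
Proof. exact: V_digit power1. Qed.

Lemma teval_tnumM rho a : teval rho (tnum a) = mul a one.
Proof. by elim: a => //= a ->; rewrite succE addC. Qed.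

(** A power other than [1] is divisible by [k]: by (Mod) it is [a + k z], and
    [V] takes the value [1] at such a number unless [a = 0]. *)
Lemma power_pred e : power e -> e = one \/ exists2 d, power d & e = mul k d.
Proof.
move=> [e_gt0 Ve].
have /= /sat_bigor [a] := hM (Mod k) (env e e e).
rewrite mem_index_iota /= => lt_a [z] /=.
rewrite !teval_shift !teval_tmulM !teval_tnumM /=.
case=> _ [ee|ea].
  case: (posnP a) => [a0|a_gt0].
    right; exists z; last by rewrite ee a0 add0x.
    split.
      apply/gt0P => z0; move: e_gt0; rewrite ee a0 z0 muln0 add0x.
      by case/ltxx.
    apply: (@mul_inj k); first by lia.
    by rewrite -V_mulk; move: Ve; rewrite ee a0 add0x.
  left; rewrite -Ve ee; case: (zero_or_gt0 z) => [->|z_gt0].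
    by rewrite muln0 addx0 V_num ?a_gt0.
  rewrite V_add ?V_num ?a_gt0 //.
  - by apply: (lt_le_trans lt01); apply: le_mul.
  - by apply: (lt_le_trans z_gt0); apply: le_mul; lia.
  rewrite V_mulk; apply: (@le_lt_trans (V z)); last first.
    by apply: lt_mul => //; exact: V_gt0.
  by apply/ltS/V_gt0.
(* The other case of the congruence makes [e] at most [a], a number below [k]. *)
left.
have [c [y [lt_c lt_y ey]]] : exists c y, [/\ c < k, lt y one & e = y + mul c one].
  apply: split_lt; apply: (@le_lt_trans (mul a one)).
    by rewrite ea addC; apply: le_addl.
  rewrite -[mul a one]add0x; apply: lt_split => //; exact: lt01.
rewrite -Ve ey (lt1P lt_y) add0x V_num // lt_c andbT lt0n.
by apply/eqP => c0; move: e_gt0; rewrite ey (lt1P lt_y) c0 addx0 => /ltxx.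
Qed.

(** ** Comprehension and induction along the powers *)

(** What the formula [digit] says of [x], [d] and [a], less the condition that
    [d] is a power. *)
Definition coeff x d (a : nat) := exists y z,
  [/\ lt y d, x = y + mul a d + z & z = 0 \/ lt d (V z)].

Lemma sat_digit rho x d a s t : teval rho s = x -> teval rho t = d ->
  sat rho (digit s t a) -> coeff x d a.
Proof.
move=> <- <- [_ [y [le_y [ne_y [z [_]]]]]] /=.
rewrite /= !teval_tmulM !teval_shift in le_y ne_y *.
by move=> [e h]; exists y, z.
Qed.

Lemma comprehensionM A rho d : Delta0 A -> power d ->
  exists2 x, lt x d & forall e, power e -> lt e d ->
    (coeff x e 1 /\ sat (scons e rho) A) \/
    (coeff x e 0 /\ ~ sat (scons e rho) A).
Proof.
move=> D0A Pd; have [x [le_x [ne_x]]] := hM (Comp k D0A) (scons d rho) Pd.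
move=> digits; exists x => // e Pe [le_e ne_e].
have satA : sat (scons e (scons x (scons d rho)))
     (fsubst (up (fun i => #(i.+2))) A) <-> sat (scons e rho) A.
  by rewrite sat_subst teval_up.
case: (digits e le_e ne_e Pe) => -[dig bA]; [left|right]; split.
- exact: sat_digit dig.
- exact/satA.
- exact: sat_digit dig.
- by move/satA.
Qed.

(** With [V_le_coeff], this makes [V x] the least position of a nonzero digit of
    [x] when all digits are [0] or [1]. *)
Lemma coeff_V x : lt 0 x -> ~ coeff x (V x) 0.
Proof.
move=> x_gt0 [y [z [lt_y ex]]]; rewrite addx0 in ex => hz.
case: (zero_or_gt0 z) hz => [z0 _|z_gt0 [z0|lt_z]].
- case: (@ltxx x); apply: (@lt_le_trans (V x)); last exact: V_le.
  by rewrite {1}ex z0 addx0.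
- by move: z_gt0; rewrite z0 => /ltxx.
case: (zero_or_gt0 y) => [y0|y_gt0].
  by move: lt_z; rewrite {1}ex y0 add0x => /ltxx.
have Vy : lt (V y) (V x) by apply: le_lt_trans lt_y; exact: V_le.
have := V_add y_gt0 z_gt0 (lt_trans Vy lt_z).
by rewrite -ex => e; move: Vy; rewrite e => /ltxx.
Qed.

Lemma V_le_coeff x d : power d -> coeff x d 1 -> s_le (V x) d.
Proof.
move=> Pd [y [z [lt_y ex hz]]]; rewrite mul1 in ex; have [d_gt0 Vd] := Pd.
have [dz_gt0 Vdz] : lt 0 (d + z) /\ V (d + z) = d.
  case: hz => [->|lt_z]; first by rewrite addx0.
  split; first by apply: (lt_le_trans d_gt0); rewrite addC; apply: le_addl.
  rewrite V_add ?Vd //; apply/gt0P => z0; move: lt_z; rewrite z0 V_zero.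
  by case: d_gt0 => le_0d ne [le_d0 _]; apply: ne; apply: le_anti.
rewrite ex -addA; case: (zero_or_gt0 y) => [->|y_gt0].
  by rewrite add0x Vdz; exact: lexx.
have Vy : lt (V y) d by apply: le_lt_trans lt_y; exact: V_le.
by rewrite V_add ?Vdz //; case: Vy.
Qed.

Lemma coeff_le x d : coeff x d 1 -> s_le d x.
Proof.
move=> [y [z [_ -> _]]]; rewrite mul1 (addC y) -addA (addC d).
exact: le_addl.
Qed.

(** By comprehension the powers up to [d] at which [A] fails are the nonzero
    digits of some [x]; then [V x] is the least of them. *)
Lemma power_ind A rho : Delta0 A ->
    sat (scons one rho) A ->
    (forall d, power d -> sat (scons d rho) A -> sat (scons (mul k d) rho) A) ->
  forall d, power d -> sat (scons d rho) A.
Proof.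
move=> D0A A1 Ak d Pd; apply: NNPP => nAd.
(* The bound [k d] instead of [d] makes [d] itself one of the digits. *)
have D0nA : Delta0 (~' A) by apply: Delta0_Imp => //; exact: Delta0_Bot.
have [x lt_x digits] := comprehensionM rho D0nA (power_mulk Pd).
have x_gt0 : lt 0 x.
  case: (digits d Pd (power_lt_mulk Pd)) => [[dig _]|[_ []]] //.
  by apply: (lt_le_trans (proj1 Pd)); apply: coeff_le.
have le_Vx := V_le x; set e := V x in le_Vx.
have Pe : power e := power_V x_gt0.
have lt_e : lt e (mul k d) by apply: le_lt_trans lt_x.
case: (digits e Pe lt_e) => [[_ nAe]|[/coeff_V //]].
case: (power_pred Pe) => [e1|[e' Pe' ee]].
  by apply: nAe; rewrite /= e1.
have lt_e' : lt e' e by rewrite ee; apply: power_lt_mulk.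
case: (digits e' Pe' (lt_trans lt_e' lt_e)) => [[dig _]|[_ nnA]].
  by case: (@ltxx e'); apply: (lt_le_trans lt_e'); apply: V_le_coeff dig.
by apply: nAe; rewrite /= ee; apply: Ak => //; apply: NNPP.
Qed.

End Model.

(** * Bounded definability *)

Definition truth_value (P : Prop) : bool := excluded_middle_informative P.

Lemma truth_valueP P : reflect P (truth_value P).
Proof.
by rewrite /truth_value; case: (excluded_middle_informative _) => h; constructor.
Qed.

Section Definable.
Variable M : structure.
Implicit Types P : M -> (nat -> M) -> Prop.

Definition definable P := exists2 A, Delta0 A &
  forall d rho, P d rho <-> sat (scons d rho) A.

Lemma definable_ext P P' :
  (forall d rho, P d rho <-> P' d rho) -> definable P -> definable P'.
Proof. by move=> eP [A D0A defA]; exists A => // d rho; rewrite -eP. Qed.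

Lemma definable_imp P P' : definable P -> definable P' ->
  definable (fun d rho => P d rho -> P' d rho).
Proof.
move=> [A D0A defA] [B D0B defB]; exists (A ->' B); first exact: Delta0_Imp.
by move=> d rho /=; rewrite defA defB.
Qed.

Lemma definable_and P P' : definable P -> definable P' ->
  definable (fun d rho => P d rho /\ P' d rho).
Proof.
move=> [A D0A defA] [B D0B defB]; exists (A /\' B); first exact: Delta0_And.
by move=> d rho /=; rewrite defA defB.
Qed.

Lemma definable_const (X : Prop) : definable (fun _ _ => X).
Proof.
case: (classic X) => hX; last by exists FBot; [exact: Delta0_Bot|].
by exists (#0 =' #0) => //; exact: Delta0_Eq.
Qed.

Lemma definable_forall (I : finType) (P : I -> M -> (nat -> M) -> Prop) :
  (forall i, definable (P i)) -> definable (fun d rho => forall i, P i d rho).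
Proof.
move=> defP; apply: (@definable_ext
  (fun d rho => forall i, i \in enum I -> P i d rho)).
  by move=> d rho; split=> Pd i; [apply: Pd; rewrite mem_enum|move=> _; apply: Pd].
elim: (enum I) => [|i s IH]; first exact: definable_ext (definable_const True).
apply: definable_ext (definable_and (defP i) IH) => d rho.
split=> [[Pi Ps] j|Pis]; first by rewrite inE => /orP [/eqP ->|/Ps].
by split=> [|j js]; apply: Pis; rewrite inE ?eqxx ?js ?orbT.
Qed.

Lemma definable_not P : definable P -> definable (fun d rho => ~ P d rho).
Proof. by move=> defP; apply: definable_imp defP (definable_const False). Qed.

Lemma definable_exists (I : finType) (P : I -> M -> (nat -> M) -> Prop) :
  (forall i, definable (P i)) -> definable (fun d rho => exists i, P i d rho).
Proof.
move=> defP; apply: definable_ext (definable_not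
  (definable_forall (fun i => definable_not (defP i)))) => d rho.
split=> [|[i Pi] nP]; last exact: nP Pi.
by move/not_all_ex_not => [i /NNPP Pi]; exists i.
Qed.

(** A property of a finite tuple of truth values of bounded formulas is a
    Boolean combination of these formulas. *)
Lemma definable_set (I : finType) (P : I -> M -> (nat -> M) -> Prop)
    (S : {set I} -> Prop) : (forall i, definable (P i)) ->
  definable (fun d rho => S [set i | truth_value (P i d rho)]).
Proof.
move=> defP; apply: (@definable_ext (fun d rho => exists X : {set I},
    S X /\ forall i, (i \in X -> P i d rho) /\ (P i d rho -> i \in X))).
  move=> d rho; split=> [[X [SX eX]]|SX].
    suff -> : [set i | truth_value (P i d rho)] = X by [].
    by apply/setP => i; rewrite inE;
      apply/truth_valueP/idP => [/(proj2 (eX i))|/(proj1 (eX i))].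
  exists [set i | truth_value (P i d rho)]; split=> // i.
  by rewrite inE; split=> /truth_valueP.
apply: definable_exists => X; apply: definable_and; first exact: definable_const.
apply: definable_forall => i; apply: definable_and.
  exact: definable_imp (definable_const _) (defP i).
exact: definable_imp (defP i) (definable_const _).
Qed.

(** Under the new quantifier the witness becomes [#0] and the bound [d] becomes
    [#1]; the formula for [P] expects them in the opposite order. *)
Definition swap_var (n : nat) : term :=
  match n with 0 => #1 | 1 => #0 | _ => #n end.

Lemma definable_exists_lt P : definable P ->
  definable (fun d rho => exists2 b, lt b d & P d (scons b rho)).
Proof.
move=> [A D0A defA]; exists (FExlt #0 (fsubst swap_var A)).
  apply: Delta0_Exle; apply: Delta0_And; last exact: Delta0_subst.
  by apply: Delta0_Imp; [exact: Delta0_Eq|exact: Delta0_Bot].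
have swap b d rho : sat (scons b (scons d rho)) (fsubst swap_var A) <->
    P d (scons b rho).
  rewrite sat_subst defA.
  suff -> : (fun n => teval (scons b (scons d rho)) (swap_var n)) =
            scons d (scons b rho) by [].
  by apply: functional_extensionality => -[|[|n]].
move=> d rho; split=> [[b [le_b ne_b] /swap Pd]|[b [le_b [ne_b /swap Pd]]]];
  by exists b.
Qed.

End Definable.

(** * Relations recognized by automata *)

Section Recognizable.
Variables (k : nat) (hk : 2 <= k).
Implicit Types (M : structure).

Definition letter := nat -> 'I_k.

Definition ord_zero : 'I_k := Ordinal (ltnW hk).

Definition blank : letter := fun _ => ord_zero.

Definition below M (D : M) (rho : nat -> M) := forall i, lt (rho i) D.

Definition write M (D : M) (rho : nat -> M) (l : letter) (i : nat) : M :=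
  s_add (rho i) (mul (l i) D).

(** An automaton reads the digits of all entries of [rho] at once, the lowest
    first.  [st D rho] is its state after the positions below the power [D]; it
    has this meaning only if all entries of [rho] are below [D], while
    definability concerns all arguments. *)
Record tracks M (Q : finType) (q0 : Q) (delta : Q -> letter -> Q)
    (st : M -> (nat -> M) -> Q) : Prop := Tracks {
  tracks_init : st (s_succ (s_zero M)) (fun _ => s_zero M) = q0;
  tracks_step D rho l : power D -> below D rho ->
    st (mul k D) (write D rho l) = delta (st D rho) l;
  tracks_def (S : Q -> Prop) : definable (fun D rho => S (st D rho)) }.

(** Automaton and acceptance condition are chosen before the model, which is what
    carries truth from one model to another. *)
Definition recognizable (R : forall M, (nat -> M) -> Prop) :=
  exists (Q : finType) (q0 : Q) (delta : Q -> letter -> Q) (F : Q -> Prop),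
  forall M, Tk_model k M -> exists2 st, tracks q0 delta st &
    forall D rho, power D -> below D rho -> R M rho <-> F (st D rho).

Lemma write_blank M (hM : Tk_model k M) (D : M) rho : write D rho blank = rho.
Proof. by apply: functional_extensionality => i; rewrite /write /= (addx0 hM). Qed.

Lemma below_le M (hM : Tk_model k M) (D D' : M) rho :
  s_le D D' -> below D rho -> below D' rho.
Proof. by move=> le_D lt_rho i; apply: (lt_le_trans hM (lt_rho i)). Qed.

(** Entries below [D] have only zeros from [D] on, and the states obtained by
    reading finitely many zeros are closed under reading one more.  Induction
    along the powers carries this to all powers of the model. *)
Lemma tracks_pad M (hM : Tk_model k M) (Q : finType) (q0 : Q) delta st (D D' : M)
    rho : tracks q0 delta st -> power D -> below D rho -> power D' ->
  s_le D D' -> exists j, st D' rho = iter j (delta^~ blank) (st D rho).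
Proof.
move=> trk PD lt_rho PD' le_D.
have [A D0A defA] := tracks_def trk
  (fun q => exists j, q = iter j (delta^~ blank) (st D rho)).
pose B := #1 <=' #0 ->' fsubst (up (fun i => #(i.+1))) A.
have satB d : sat (scons d (scons D rho)) B <->
    (s_le D d -> exists j, st d rho = iter j (delta^~ blank) (st D rho)).
  by rewrite /= sat_subst teval_up defA.
apply: (proj1 (satB D') _ le_D); apply: (power_ind hk hM) => //.
- by apply: Delta0_Imp; [exact: Delta0_Le|exact: Delta0_subst].
- apply/satB => le_D1; exists 0.
  suff -> : s_succ (s_zero M) = D by [].
  by apply: (le_anti hM) => //; apply/(ltS hM); case: PD.
move=> d Pd /satB IH; apply/satB => le_Dk.
case: (lt_or_le hM d D) => [lt_dD|le_Dd].
  exists 0; suff -> : mul k d = D by [].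
  by apply: (le_anti hM) => //; apply: (power_gap hM).
have [j ej] := IH le_Dd; exists j.+1; rewrite /= -ej.
by rewrite -(tracks_step trk _ Pd) ?write_blank //; apply: (below_le hM) lt_rho.
Qed.

Lemma recognizable_ext (R R' : forall M, (nat -> M) -> Prop) :
    (forall M rho, Tk_model k M -> R M rho <-> R' M rho) ->
  recognizable R -> recognizable R'.
Proof.
move=> eR [Q [q0 [delta [F rec]]]]; exists Q, q0, delta, F => M hM.
by have [st trk acc] := rec M hM; exists st => // D rho PD lt_rho;
  have := eR M rho hM; have := acc D rho PD lt_rho; tauto.
Qed.

Lemma recognizable_bot : recognizable (fun _ _ => False).
Proof.
exists unit, tt, (fun _ _ => tt), (fun _ => False) => M _.
by exists (fun _ _ => tt) => //; split=> // S; apply: definable_const.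
Qed.

Lemma recognizable_imp (R R' : forall M, (nat -> M) -> Prop) :
    recognizable R -> recognizable R' ->
  recognizable (fun M rho => R M rho -> R' M rho).
Proof.
move=> [Q [q0 [delta [F rec]]]] [Q' [q0' [delta' [F' rec']]]].
exists (Q * Q')%type, (q0, q0'), (fun q l => (delta q.1 l, delta' q.2 l)),
  (fun q => F q.1 -> F' q.2) => M hM.
have [st trk acc] := rec M hM; have [st' trk' acc'] := rec' M hM.
exists (fun D rho => (st D rho, st' D rho)); last first.
  move=> D rho PD lt_rho /=.
  by have := acc D rho PD lt_rho; have := acc' D rho PD lt_rho; tauto.
split.
- by rewrite (tracks_init trk) (tracks_init trk').
- by move=> D rho l PD lt_rho; rewrite (tracks_step trk) ?(tracks_step trk').
move=> S; apply: (@definable_ext _ (fun D rho => exists q : Q * Q',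
    S q /\ (st D rho = q.1 /\ st' D rho = q.2))).
  by move=> D rho; split=> [[[q q'] /= [Sq [-> ->]]] //|Sq]; eexists; split;
    first exact: Sq.
apply: definable_exists => q; apply: definable_and; first exact: definable_const.
by apply: definable_and; [apply: (tracks_def trk (fun r => r = q.1))|
  apply: (tracks_def trk' (fun r => r = q.2))].
Qed.

(** The alphabet consists of the assignments of digits to all variables, so
    substituting variables amounts to permuting or duplicating digits. *)
Lemma recognizable_reindex (f : nat -> nat) (R : forall M, (nat -> M) -> Prop) :
  recognizable R -> recognizable (fun M rho => R M (fun i => rho (f i))).
Proof.
move=> [Q [q0 [delta [F rec]]]].
exists Q, q0, (fun q l => delta q (fun i => l (f i))), F => M hM.
have [st trk acc] := rec M hM.
exists (fun D rho => st D (fun i => rho (f i))); last first.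
  by move=> D rho PD lt_rho; apply: acc => // i; apply: lt_rho.
split; first exact: (tracks_init trk).
  by move=> D rho l PD lt_rho; rewrite -(tracks_step trk) // => i; apply: lt_rho.
move=> S; have [A D0A defA] := tracks_def trk S.
exists (fsubst (up (fun i => #(f i))) A); first exact: Delta0_subst.
by move=> D rho; rewrite sat_subst teval_up -defA.
Qed.

(** The subset construction: the state after reading [rho] below [D] is the set
    of the states reached with any witness below [D], which is a bounded
    quantification.  A witness may have more digits than were read, hence
    the acceptance of the sets from which an accepting state is reached by reading
    zeros. *)
Lemma recognizable_ex (R : forall M, (nat -> M) -> Prop) :
  recognizable R -> recognizable (fun M rho => exists a, R M (scons a rho)).
Proof.
move=> [Q [q0 [delta [F rec]]]].
pose delta' (X : {set Q}) (l : letter) : {set Q} :=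
  [set q | [exists p in X, exists c : 'I_k, delta p (scons c l) == q]].
exists {set Q}, [set q0], delta',
  (fun X => exists j, exists2 q, q \in iter j (delta'^~ blank) X & F q) => M hM.
have [st trk acc] := rec M hM.
pose st' D rho := [set q | truth_value (exists2 b, lt b D & st D (scons b rho)
  = q)].
have trk' : tracks [set q0] delta' st'.
  split.
  - apply/setP => q; rewrite !inE.
    have scons0 : scons (s_zero M) (fun _ => s_zero M) = fun _ => s_zero M.
      by apply: functional_extensionality => -[].
    apply/truth_valueP/eqP => [[b /(lt1P hM) ->]|->];
      first by rewrite scons0 (tracks_init trk).
    by exists (s_zero M); [exact: (lt01 hM)|rewrite scons0 (tracks_init trk)].
  - move=> D rho l PD lt_rho; apply/setP => q; rewrite !inE.
    have step b (c : 'I_k) : lt b D ->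
        st (mul k D) (scons (s_add b (mul c D)) (write D rho l)) =
        delta (st D (scons b rho)) (scons c l).
      move=> lt_b; rewrite -(tracks_step trk) //; last by case.
      by congr st; apply: functional_extensionality => -[].
    apply/truth_valueP/exists_inP => [[x /(split_lt hM)]|[p]].
      move=> [c [b [lt_c lt_b ->]]] <-; exists (st D (scons b rho)).
        by rewrite inE; apply/truth_valueP; exists b.
      by apply/existsP; exists (Ordinal lt_c); rewrite -step.
    rewrite inE => /truth_valueP [b lt_b <-] /existsP [c /eqP <-].
    exists (s_add b (mul c D)); last exact: step.
    exact: (lt_split hM).
  move=> S; apply: definable_set => q.
  exact: (definable_exists_lt (tracks_def trk (fun r => r = q))).
exists st' => // D rho PD lt_rho; split=> [[a Ra]|[j [q]]].
  (* All digits of the witness lie below some power [D'] beyond [D]. *)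
  have [E PE lt_a] := power_above hk hM a.
  have [D' [PD' le_D lt_aD']] : exists D', [/\ power D', s_le D D' & lt a D'].
    case: (le_total hM D E) => le_DE; first by exists E.
    by exists D; split=> //; [exact: (lexx hM)|exact: (lt_le_trans hM) le_DE].
  have [j ej] := tracks_pad hM trk' PD lt_rho PD' le_D.
  exists j, (st D' (scons a rho)).
    by rewrite -ej inE; apply/truth_valueP; exists a.
  by rewrite -acc // => -[//|i]; apply: (below_le hM le_D lt_rho).
(* Conversely finitely many zeros lead to the power [k ^ j D]. *)
have [D' [PD' le_D <-]] : exists D', [/\ power D', s_le D D' &
    st' D' rho = iter j (delta'^~ blank) (st' D rho)].
  elim: j => [|j [D' [PD' le_D eD']]]; first by exists D; split=> //;
    exact: (lexx hM).
  exists (mul k D'); split; first exact: (power_mulk hk hM).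
    by apply: (le_trans hM le_D); case: (power_lt_mulk hk hM PD').
  rewrite /= -eD' -(tracks_step trk') ?write_blank //.
  exact: (below_le hM) lt_rho.
rewrite inE => /truth_valueP [a lt_a <-] Fq; exists a; apply/(acc D') => // -[//|i].
exact: (below_le hM le_D lt_rho i).
Qed.

Lemma digits_unique M (hM : Tk_model k M) (D x y : M) a b :
  lt x D -> lt y D -> s_add x (mul a D) = s_add y (mul b D) -> x = y /\ a = b.
Proof.
wlog le_ab : a b x y / a <= b.
  move=> W lt_x lt_y e; case: (leqP a b) => [le_ab|/ltnW le_ba]; first exact: W.
  by have [-> ->] := W b a y x le_ba lt_y lt_x (esym e).
move=> lt_x lt_y; rewrite -(subnK le_ab) (mulD hM) (addA hM) => /(addIr hM) ex.
have [eb|b_gt0] := posnP (b - a); first by rewrite ex eb /= (addx0 hM).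
case: (@ltxx M D); apply: (le_lt_trans hM) lt_x; rewrite ex.
apply: (le_trans hM) (le_addl hM _ _); exact: (le_mul hM).
Qed.

(** The carry out of the digits below [D] is at most one, since [x + y] is below
    [2 D]. *)
Lemma add_digits M (hM : Tk_model k M) (D x y z : M) n m :
    lt x D -> lt y D -> lt z D ->
  s_add (s_add x y) (mul n D) = s_add z (mul m D) <->
  exists c : bool, s_add x y = s_add z (mul c D) /\ c + n = m.
Proof.
move=> lt_x lt_y lt_z; split=> [e|[c [-> <-]]]; last first.
  by rewrite -(addA hM) -(mulD hM).
have lt_xy : lt (s_add x y) (mul 2 D).
  by rewrite mulS (mul1 hM); apply: (lt_add2 hM).
have [c [w [lt_c lt_w ew]]] := split_lt hM lt_xy.
move: e; rewrite ew -(addA hM) -(mulD hM) => /(digits_unique hM lt_w lt_z) [-> <-].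
by exists (c == 1); split; case: c lt_c {ew} => [|[]].
Qed.

Lemma add_mulACA M (hM : Tk_model k M) (D x y : M) a b :
  s_add (s_add x (mul a D)) (s_add y (mul b D)) =
  s_add (s_add x y) (mul (a + b) D).
Proof. by rewrite (addACA hM) -(mulD hM). Qed.

(** The school algorithm: the state records the carries [c] with
    [x + y = z + c D]. *)
Lemma recognizable_add : recognizable (fun M rho => s_add (rho 0) (rho 1) = rho 2).
Proof.
pose delta (X : {set bool}) (l : letter) : {set bool} :=
  [set c' : bool | [exists c : bool in X, (c : nat) + (l 0 + l 1) == l 2 + c' * k]].
exists {set bool}, [set false], delta, (fun X : {set bool} => false \in X :
  Prop) => M hM.
exists (fun D rho => [set c : bool | truth_value
  (s_add (rho 0) (rho 1) = s_add (rho 2) (mul c D))]); last first.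
  move=> D rho PD lt_rho; rewrite inE /=.
  by split=> [e|/truth_valueP]; [apply/truth_valueP|]; rewrite (addx0 hM).
split.
- apply/setP => c; rewrite !inE; apply/truth_valueP/eqP => [|-> /=]; last by [].
  case: c => //=; rewrite !(addx0 hM) (add0x hM) => e.
  by case: (@ltxx M (s_zero M)); rewrite {2}e; exact: (lt01 hM).
- move=> D rho l PD lt_rho; apply/setP => c'; rewrite !inE /write.
  rewrite add_mulACA // (mulA hM) -(addA hM (rho 2)) -(mulD hM).
  apply/truth_valueP/exists_inP => [/(add_digits hM) [||| c [e1 e2]] //|[c]].
    by exists c; [rewrite inE; apply/truth_valueP|apply/eqP].
  rewrite inE => /truth_valueP e1 /eqP e2; apply/(add_digits hM) => //.
  by exists c.
move=> S; apply: definable_set => c; exists (#1 +' #2 =' #3 +' tmul c #0).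
  exact: Delta0_Eq.
by move=> D rho /=; rewrite teval_tmulM.
Qed.

(** The state records which of [x = 0], [y = 0] and [V x = y] hold; a digit
    written in front of a nonzero [x] does not change [V x]. *)
Lemma recognizable_V : recognizable (fun M rho => s_V (rho 0) = rho 1).
Proof.
pose fact M i (rho : nat -> M) := match i with
  | None => rho 0 = s_zero M
  | Some false => rho 1 = s_zero M
  | Some true => s_V (rho 0) = rho 1
  end.
pose delta (X : {set option bool}) (l : letter) : {set option bool} :=
  [set i | match i with
    | None => (None \in X) && (l 0 == 0 :> nat)
    | Some false => (Some false \in X) && (l 1 == 0 :> nat)
    | Some true => if None \in X
                   then (Some false \in X) && (l 1 == (l 0 != 0 :> nat) :> nat)
                   else (Some true \in X) && (l 1 == 0 :> nat)
    end].
exists {set option bool}, setT, delta, (fun X : {set option bool} => Some true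
  \in X : Prop) => M hM.
exists (fun D rho => [set i | truth_value (fact M i rho)]); last first.
  by move=> D rho PD lt_rho; rewrite inE /=; split=> /truth_valueP.
split.
- apply/setP => i; rewrite !inE; apply/truth_valueP.
  by case: i => [[]|] //=; exact: (V_zero hM).
- move=> D rho l PD lt_rho; have D_gt0 := proj1 PD.
  have uniq0 x a : lt x D -> s_add x (mul a D) = s_zero M <-> x = s_zero M /\ a = 0.
    move=> lt_x; split=> [e|[-> ->]]; last exact: (addx0 hM).
    by apply: (digits_unique hM lt_x D_gt0); rewrite e /= (addx0 hM).
  apply/setP => -[[]|]; rewrite !inE /write /=; last 2 first.
  + apply/truth_valueP/andP => [/(uniq0 _ _ (lt_rho 1)) [e1 e2]|[/truth_valueP
    e1 /eqP e2]].
      by split; [apply/truth_valueP|apply/eqP].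
    exact/uniq0.
  + apply/truth_valueP/andP => [/(uniq0 _ _ (lt_rho 0)) [e1 e2]|[/truth_valueP
    e1 /eqP e2]].
      by split; [apply/truth_valueP|apply/eqP].
    exact/uniq0.
  case: (truth_valueP (rho 0 = s_zero M)) => [e0|ne0].
    have -> : s_V (s_add (rho 0) (mul (l 0) D)) = mul ((l 0 : nat) != 0) D.
      rewrite e0 (add0x hM); case: (posnP (l 0)) => [-> /=|l_gt0];
        first exact: (V_zero hM).
      by rewrite (V_digit hM PD) ?l_gt0 ?ltn_ord //; exact: (esym (mul1 hM D)).
    apply/truth_valueP/andP => [e|[/truth_valueP -> /eqP ->]];
      last by rewrite (add0x hM).
    have [e1 e2] : s_zero M = rho 1 /\ ((l 0 : nat) != 0 : nat) = l 1.
      by apply: (digits_unique hM D_gt0 (lt_rho 1)); rewrite (add0x hM).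
    by split; [apply/truth_valueP|apply/eqP].
  have x_gt0 : lt (s_zero M) (rho 0) by apply/(gt0P hM).
  have -> : s_V (s_add (rho 0) (mul (l 0) D)) = s_V (rho 0).
    case: (posnP (l 0)) => [-> /=|l_gt0]; first by rewrite (addx0 hM).
    by apply: (V_add_small hM); rewrite ?l_gt0 ?ltn_ord.
  have lt_V : lt (s_V (rho 0)) D by apply: (le_lt_trans hM) (lt_rho 0);
    exact: (V_le hM).
  apply/truth_valueP/andP => [e|[/truth_valueP -> /eqP ->]];
    last by rewrite /= (addx0 hM).
  have [e1 e2] : s_V (rho 0) = rho 1 /\ 0 = l 1.
    by apply: (digits_unique hM lt_V (lt_rho 1)); rewrite /= (addx0 hM).
  by split; [apply/truth_valueP|apply/eqP].
move=> S; apply: definable_set => -[[]|].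
- by exists (TV #1 =' #2) => //; exact: Delta0_Eq.
- by exists (#2 =' TZero) => //; exact: Delta0_Eq.
- by exists (#1 =' TZero) => //; exact: Delta0_Eq.
Qed.

Lemma recognizable_and (R R' : forall M, (nat -> M) -> Prop) :
    recognizable R -> recognizable R' ->
  recognizable (fun M rho => R M rho /\ R' M rho).
Proof.
move=> recR recR'; apply: recognizable_ext (recognizable_imp
  (recognizable_imp recR (recognizable_imp recR' recognizable_bot))
  recognizable_bot) => M rho _; tauto.
Qed.

Lemma recognizable_not (R : forall M, (nat -> M) -> Prop) :
  recognizable R -> recognizable (fun M rho => ~ R M rho).
Proof. by move=> recR; apply: recognizable_imp recR recognizable_bot. Qed.

Lemma recognizable_or (R R' : forall M, (nat -> M) -> Prop) :
    recognizable R -> recognizable R' ->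
  recognizable (fun M rho => R M rho \/ R' M rho).
Proof.
move=> recR recR'; apply: recognizable_ext
  (recognizable_imp (recognizable_not recR) recR') => M rho _; tauto.
Qed.

Lemma recognizable_all (R : forall M, (nat -> M) -> Prop) :
  recognizable R -> recognizable (fun M rho => forall a, R M (scons a rho)).
Proof.
move=> recR; apply: recognizable_ext
  (recognizable_not (recognizable_ex (recognizable_not recR))) => M rho _.
split=> [nR a|allR [a []] //]; apply: NNPP => nRa; apply: nR; by exists a.
Qed.

Lemma recognizable_add_at i j n :
  recognizable (fun M rho => s_add (rho i) (rho j) = rho n).
Proof.
exact: (recognizable_reindex (fun m => nth n [:: i; j] m) recognizable_add).
Qed.

Lemma recognizable_zero i : recognizable (fun M rho => s_zero M = rho i).
Proof.
apply: recognizable_ext (recognizable_add_at i i i) => M rho hM.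
split=> [e|<-]; last exact: (addx0 hM).
by apply/esym/(addIr hM (z := rho i)); rewrite e (add0x hM).
Qed.

Lemma recognizable_eq i j : recognizable (fun M rho => rho i = rho j).
Proof.
apply: recognizable_ext (recognizable_ex (recognizable_and
  (recognizable_zero 0) (recognizable_add_at i.+1 0 j.+1))) => M rho hM.
split=> /= [[z [<- <-]]|->]; first by rewrite (addx0 hM).
by exists (s_zero M); rewrite (addx0 hM).
Qed.

Lemma recognizable_le i j : recognizable (fun M rho => s_le (rho i) (rho j)).
Proof.
apply: recognizable_ext (recognizable_ex (recognizable_add_at 0 i.+1 j.+1)).
by move=> M rho hM; rewrite (leP hM).
Qed.

(** [1] is the least nonzero element. *)
Lemma recognizable_one i : recognizable (fun M rho => s_succ (s_zero M) = rho i).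
Proof.
apply: recognizable_ext (recognizable_and
  (recognizable_not (recognizable_zero i))
  (recognizable_all (recognizable_or (recognizable_zero 0)
    (recognizable_le i.+1 0)))) => M rho hM /=.
split=> [[ne0 least]|<-].
  apply: (le_anti hM); first by apply/(ltS hM)/(gt0P hM) => e; apply: ne0.
  by case: (least (s_succ (s_zero M))) => // e; case: (lt01 hM).
split=> [e|a]; first by case: (lt01 hM).
by case: (zero_or_gt0 hM a) => [|/(ltS hM)]; [left|right].
Qed.

(** Terms are unnested by existential quantifiers over the values of their
    subterms, so that only variables occur in atomic formulas. *)
Lemma recognizable_term t :
  recognizable (fun M rho => teval (fun n => rho n.+1) t = rho 0).
Proof.
elim: t => [n||t IH|t IHt u IHu|t IH] /=.
- exact: recognizable_eq.
- exact: recognizable_zero.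
- apply: recognizable_ext (recognizable_ex (recognizable_ex (recognizable_and
    (recognizable_reindex (fun i => if i is n.+1 then n.+3 else 1) IH)
    (recognizable_and (recognizable_one 0) (recognizable_add_at 1 0 2))))).
  move=> M rho hM /=; split=> [[x [y [-> [<- <-]]]]|<-];
    first by rewrite (succE hM).
  by eexists; eexists; split; last split; try reflexivity; rewrite /= -(succE hM).
- apply: recognizable_ext (recognizable_ex (recognizable_ex (recognizable_and
    (recognizable_reindex (fun i => if i is n.+1 then n.+3 else 1) IHt)
    (recognizable_and
    (recognizable_reindex (fun i => if i is n.+1 then n.+3 else 0) IHu)
    (recognizable_add_at 1 0 2))))).
  move=> M rho hM /=; split=> [[x [y [-> [-> <-]]]]//|<-].
  by eexists; eexists; split; last split; reflexivity.
- apply: recognizable_ext (recognizable_ex (recognizable_and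
    (recognizable_reindex (fun i => if i is n.+1 then n.+2 else 0) IH)
    (recognizable_reindex (fun i => i) recognizable_V))).
  move=> M rho hM /=; split=> [[x [-> <-]]//|<-].
  by eexists; split; reflexivity.
Qed.

Theorem recognizable_form A : recognizable (fun M rho => sat rho A).
Proof.
elim: A => [|s t|s t|A IHA B IHB|A IHA B IHB|A IHA B IHB|A IH|A IH] /=.
- exact: recognizable_bot.
- apply: recognizable_ext (recognizable_ex (recognizable_and
    (recognizable_term s) (recognizable_term t))) => M rho hM /=.
  by split=> [[x [-> ->]]//|->]; eexists; split; reflexivity.
- apply: recognizable_ext (recognizable_ex (recognizable_ex (recognizable_and
    (recognizable_reindex (fun i => if i is n.+1 then n.+2 else 1)
      (recognizable_term s))
    (recognizable_and
    (recognizable_reindex (fun i => if i is n.+1 then n.+2 else 0)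
      (recognizable_term t))
    (recognizable_le 1 0))))) => M rho hM /=.
  split=> [[x [y [-> [-> ?]]]]//|h]; by eexists; eexists; split; last split;
    try reflexivity.
- exact: recognizable_and.
- exact: recognizable_or.
- exact: recognizable_imp.
- exact: (recognizable_all IH).
- exact: (recognizable_ex IH).
Qed.

(** Evaluate the sentence at the zero assignment.  Its entries are below the
    power [1], where no digit has been read and the automaton is in its initial
    state, whatever the model. *)
Lemma Tk_elementary M N A : Tk_model k M -> Tk_model k N -> sentence A ->
  models M A -> models N A.
Proof.
move=> hM hN clA mA rho; apply: sat_sentence clA _.
have [Q [q0 [delta [F rec]]]] := recognizable_form A.
have [stM trkM accM] := rec M hM; have [stN trkN accN] := rec N hN.
have below0 K (hK : Tk_model k K) : below (s_succ (s_zero K)) (fun _ => s_zero K).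
  by move=> i; exact: (lt01 hK).
apply/(accN _ (fun _ => s_zero N) (power1 hN) (below0 N hN)).
rewrite (tracks_init trkN) -(tracks_init trkM).
by apply/(accM _ _ (power1 hM) (below0 M hM)); apply: mA.
Qed.

End Recognizable.

(** * Bounded axioms, and the theorem *)

Lemma sentence_uclosure A : sentence (uclosure A).
Proof.
have bound_iter n B : fbound (iter n FAll B) = fbound B - n.
  by elim: n => [|n /= ->]; rewrite ?subn0 // subnS.
by rewrite /sentence /uclosure bound_iter subnn.
Qed.

Lemma Delta0_bigor (r : seq nat) (F : nat -> form) :
  (forall a, Delta0 (F a)) -> Delta0 (\big[FOr/FBot]_(a <- r) F a).
Proof.
by move=> D0F; elim/big_ind: _ => //; [exact: Delta0_Bot|exact: Delta0_Or].
Qed.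

Lemma Delta0_not A : Delta0 A -> Delta0 (~' A).
Proof. by move=> D0A; apply: Delta0_Imp => //; exact: Delta0_Bot. Qed.

Lemma Delta0_bigand (r : seq nat) (F : nat -> form) :
  (forall a, Delta0 (F a)) -> Delta0 (\big[FAnd/FTop]_(a <- r) F a).
Proof.
move=> D0F; elim/big_ind: _ => //; last exact: Delta0_And.
exact: Delta0_not Delta0_Bot.
Qed.

Lemma Delta0_lt s t : Delta0 (s <' t).
Proof. by apply: Delta0_And; [|apply: Delta0_not]; constructor. Qed.

Lemma Delta0_isP d : Delta0 (isP d).
Proof. by apply: Delta0_And; [exact: Delta0_lt|exact: Delta0_Eq]. Qed.

Lemma Delta0_Exlt t A : Delta0 A -> Delta0 (FExlt t A).
Proof.
move=> D0A; apply: Delta0_Exle; apply: Delta0_And => //.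
by apply: Delta0_not; constructor.
Qed.

Lemma Delta0_Alllt t A : Delta0 A -> Delta0 (FAlllt t A).
Proof.
move=> D0A; apply: Delta0_Allle; apply: Delta0_Imp => //.
by apply: Delta0_not; constructor.
Qed.

Lemma Delta0_digit x d a : Delta0 (digit x d a).
Proof.
apply: Delta0_And; first exact: Delta0_isP.
apply: Delta0_Exlt; apply: Delta0_Exle.
by do ![exact: Delta0_lt | constructor].
Qed.

Lemma Delta0_Tax k A : Tax k A -> Delta0 A.
Proof.
have D0lt := Delta0_lt; have D0P := Delta0_isP.
case=> {A}; try by do ![exact: Delta0_lt | exact: Delta0_isP | constructor].
- by apply: Delta0_bigor => a; do !constructor.
- by apply: Delta0_Imp => //; apply: Delta0_bigand => a; constructor.
- apply: Delta0_Imp => //; apply: Delta0_Exle; apply: Delta0_bigor => a.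
  by do ![exact: Delta0_lt | constructor].
move=> A D0A A'; have D0A' : Delta0 A' by exact: Delta0_subst.
apply: Delta0_Imp => //; apply: Delta0_Exlt; apply: Delta0_Alllt.
apply: Delta0_Imp => //.
by apply: Delta0_Or; apply: Delta0_And;
  do ?[exact: Delta0_digit | exact: Delta0_not].
Qed.

Lemma Tk_complete k A : 2 <= k -> sentence A -> ((Tk k |-' A) <-> BA k A).
Proof.
move=> hk clA; split=> [[G TG pA]|[_ NA]].
  split=> // rho; apply: (soundness pA) => B inB.
  exact: (stdmodel_Tk hk (TG B inB)).
apply: completeness => // [B [C _ ->]|M MT]; first exact: sentence_uclosure.
apply: (Tk_elementary hk (M := stdmodel k)) => // B TB.
  exact: stdmodel_Tax.
by apply/models_uclosure; apply: MT; exists B.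
Qed.

Theorem theorem6 (k : nat) (hk : 2 <= k) :
  (forall A : form, sentence A -> ((Tk k |-' A) <-> BA k A)) /\
  (exists Ax : theory,
     (forall A : form, Ax A -> sentence A /\ Pi1 A) /\
     (forall A : form, sentence A -> ((Ax |-' A) <-> BA k A))).
Proof.
split=> [A|]; first exact: Tk_complete.
exists (Tk k); split=> [A [B TB ->]|A]; last exact: Tk_complete.
split; first exact: sentence_uclosure.
by exists (fbound B), B; split=> //; exact: Delta0_Tax TB.
Qed.
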